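(* There exists a finite abelian group $G_0$ such that the discrete periodic tiling conjecture fails for $G = \mathbb{Z}^2 \times G_0$. That is, there exist a finite abelian group $G_0$ and a finite non-empty subset $F \subset \mathbb{Z}^2 \times G_0$ such that $F$ tiles $\mathbb{Z}^2 \times G_0$ by translations, but $F$ does not periodically tile $\mathbb{Z}^2 \times G_0$ by translations.
   Context: Let $G = (G,+)$ be a discrete abelian group. For subsets $A, F \subset G$, write $A \oplus F = G$ if every element of $G$ has a unique representation in the form $a+f$ with $a \in A$, $f \in F$. One says that $F$ tiles $G$ by translations if there exists $A \subset G$ with $A \oplus F = G$. A subset $A \subset G$ is called periodic if it is a finite union of cosets of a finite index subgroup of $G$. One says that $F$ periodically tiles $G$ by translations if there exists a periodic $A \subset G$ with $A \oplus F = G$. The discrete periodic tiling conjecture for a finitely generated discrete abelian group $G$ asserts that every finite non-empty subset $F$ of $G$ which tiles $G$ by translations also periodically tiles $G$ by translations. *)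

(* Defs.v *)
From mathcomp Require Import all_boot all_order all_algebra.
From mathcomp Require Import boolp classical_sets functions cardinality.

Set Implicit Arguments.
Unset Strict Implicit.
Unset Printing Implicit Defensive.

Import GRing.Theory.
Local Open Scope classical_set_scope.
Local Open Scope ring_scope.

Section Tilings.
Variable G : zmodType.
Implicit Types A F H : set G.

Definition direct_sum_decomposition A F : Prop :=
  forall x : G, exists! p : G * G, [/\ A p.1, F p.2 & p.1 + p.2 = x].

Definition tiles F : Prop := exists A, direct_sum_decomposition A F.

Definition subgroup H : Prop := zmod_closed (mem H).

Definition translate H (x : G) : set G := [set x + h | h in H].

(* The index of H is the number of distinct cosets, so the finiteness is that
   of a set of sets. *)
Definition finite_index H : Prop := finite_set (range (translate H)).

Definition periodic A : Prop :=
  exists H, [/\ subgroup H, finite_index H &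
    exists2 C : set G, finite_set C & A = \bigcup_(c in C) translate H c].

Definition periodically_tiles F : Prop :=
  exists2 A, periodic A & direct_sum_decomposition A F.

Definition periodic_tiling_conjecture : Prop :=
  forall F, finite_set F -> F !=set0 -> tiles F -> periodically_tiles F.

Lemma subgroupE H :
  subgroup H <-> H 0 /\ (forall x y, H x -> H y -> H (x - y)).
Proof.
split=> [[H0 HB]|[H0 HB]].
- by split=> [|x y Hx Hy]; [exact: set_mem | apply/set_mem/HB; exact/mem_set].
- split; first exact/mem_set.
  by move=> x y /set_mem Hx /set_mem Hy; apply/mem_set/HB.
Qed.

Lemma not_periodic_tiling_conjectureE :
  ~ periodic_tiling_conjecture <->
  exists F, [/\ finite_set F, F !=set0, tiles F & ~ periodically_tiles F].
Proof.
split=> [nP|[F [finF F0 tF ntF]] P]; last exact/ntF/P.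
apply: contrapT => nE; apply: nP => F finF F0 tF.
by apply: contrapT => ntF; apply: nE; exists F.
Qed.

End Tilings.

(* Main.v *)
(* A finite system of local rules on functions of linear forms in (x, y) without
   periodic solution is encoded as a tiling by one tile.

   The rules are those obeyed by the last nonzero base-8 digit Phi read along
   x + 8jy, y + 8jx (j < 6), x + y and x - y.  An auxiliary part of the system
   reveals the residues mod 8, which fixes each function off a single class mod 8.
   On that class the rules force the same picture one scale further down, so the
   values sampled along it solve the same problem; an 8-fold smaller period
   results, and infinite descent rules out every period.

   Functions are encoded by bits, and a bit by an element of {a, a + 1} in Z/4
   which an extra coordinate t in Z/2 exchanges with the other one.  That the pair
   {v(t), v(t + 1)} be {a, a + 1} with a constant is a tiling equation; applied to
   a signed sum v of three bits it says that the three are everywhere equal or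
   nowhere all equal.  A second copy of the plane, whose bits are pinned, excludes
   the first alternative, and clauses "not all equal" express any finite rule.

   Finally the equations, graph + R_m = group for m in M, are merged into one by
   stacking the R_m on separate labels of an additional finite group. *)

From HB Require Import structures.
Require Import Defs.
From mathcomp Require Import all_boot all_order all_algebra.
From mathcomp Require Import boolp classical_sets functions cardinality.
From mathcomp Require Import zify ring.

Set Implicit Arguments.
Unset Strict Implicit.
Unset Printing Implicit Defensive.

Import Order.TTheory GRing.Theory Num.Theory.
Local Open Scope classical_set_scope.
Local Open Scope ring_scope.

HB.instance Definition _ (M N : finZmodType) := GRing.Zmodule.on (M * N)%type.
HB.instance Definition _ (I : finType) (M : finZmodType) :=
  GRing.Zmodule.on {ffun I -> M}.

(** * From systems of equations to one tile *)

Definition periodic_fun (G : zmodType) T (f : G -> T) :=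
  forall h, exists2 n, (0 < n)%N & forall g, f (g + h *+ n) = f g.

(** By pigeonhole two multiples of [x] lie in the same coset. *)
Lemma finite_index_multiple (X : zmodType) (L : set X) (x : X) :
  subgroup L -> finite_index L -> exists2 n, (0 < n)%N & L (x *+ n).
Proof.
move=> /subgroupE[L0 LB] finL.
have [i [j [ij E]]] : exists i j,
    (i < j)%N /\ translate L (x *+ i) = translate L (x *+ j).
  apply: contrapT => nE; apply: infinite_nat.
  pose F i := translate L (x *+ i).
  have -> : [set: nat] = F @^-1` range (translate L).
    by apply/seteqP; split=> // i _; exists (x *+ i).
  apply: finite_preimage finL => i j _ _ E.
  apply: contrapT => /eqP; rewrite neq_ltn => /orP[] lt; apply: nE.
    by exists i, j.
  by exists j, i.
exists (j - i)%N; first by rewrite subn_gt0.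
have : translate L (x *+ j) (x *+ j) by exists 0; rewrite ?addr0.
rewrite -E => -[h Lh hE].
by rewrite mulrnBr ?(ltnW ij) // -hE addrC addKr.
Qed.

Section SystemToTile.
Variables (G : zmodType) (H : finZmodType) (M : finType).
Variable R : M -> set (G * H).

(** That is, the graph of [f] and each [R m] decompose [G * H] as a direct sum. *)
Definition solves (f : G -> H) :=
  forall m g s, exists! r : G * H, R m r /\ f (g + r.1) + r.2 = s.

Hypothesis finR : forall m, finite_set (R m).

Lemma supportP : exists hs : seq G, forall m r, R m r -> r.1 \in hs.
Proof.
have /choice[S SP] (m : M) : exists s : seq (G * H), R m = [set` s].
  exact/finite_seqP/finR.
exists (flatten [seq [seq r.1 | r <- S m] | m <- enum M]) => m r.
rewrite SP /= => rS; apply/flatten_mapP; exists m; first by rewrite mem_enum.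
exact: map_f.
Qed.

Variable hs : seq G.
Hypothesis hsP : forall m r, R m r -> r.1 \in hs.

(* Each equation gets two markers: the difference of the labels of two tiles related
   by the equation translates both of them to markers, hence vanishes, as the markers
   form a Sidon set.  The second factor provides enough unmarked labels for there to
   be exactly one tile over each base point. *)
Definition label : finZmodType :=
  ({ffun M * bool -> 'I_3} * 'I_(size hs).+3)%type.
Definition marker (mb : M * bool) : label := ([ffun x => (x == mb)%:R], 0).

Lemma marker_inj : injective marker.
Proof.
move=> a b [] /ffunP /(_ a); rewrite !ffunE eqxx.
by case: eqVneq.
Qed.

Lemma marker_sidon (k : label) a b c d :
  a != b -> k + marker a = marker c -> k + marker b = marker d -> k = 0.
Proof.
move=> ab ka kb.
suff ac : a = c by apply: (addIr (marker a)); rewrite ka add0r ac.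
apply/eqP/negP => /negP ac.
have /(congr1 fst)/= /ffunP /(_ a) : marker c - marker a = marker d - marker b.
  by rewrite -ka -kb !addrK.
rewrite !ffunE eqxx (negPf ab) (negPf ac).
by case: (a == d).
Qed.

(** [cell] is the product of [G], [H] and [label] up to a regrouping of factors; the application
    gathers the finite factors next to [int * int]. *)
Variables (cell : zmodType) (cel : G -> H -> label -> cell).
Hypothesis cel_surj : forall z, exists g s k, z = cel g s k.
Hypothesis celD : forall g s k g' s' k',
  cel g s k + cel g' s' k' = cel (g + g') (s + s') (k + k').
Hypothesis cel_inj : forall g s k g' s' k',
  cel g s k = cel g' s' k' -> [/\ g = g', s = s' & k = k'].

Definition unmarked (k : label) := forall mb, k <> marker mb.

(** Over an unmarked label the tile is a whole fibre [H], so a graph placed at label 0 fills these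
    layers for any [f]. Over a marker of [m] it is [R m] with the base point negated, since the tile
    at [g + r.1] has to cover a cell over [g]. *)
Definition tile : set cell := [set z |
  (exists e k, unmarked k /\ z = cel 0 e k) \/
  (exists mb r, R mb.1 r /\ z = cel (- r.1) r.2 (marker mb))].

Lemma tile_finite : finite_set tile.
Proof.
pose s := [seq cel (- h) e.1 e.2 | h <- 0 :: hs, e <- enum {: H * label}].
have sP h e k : h \in 0 :: hs -> cel (- h) e k \in s.
  move=> hhs; apply: (allpairs_f (fun h e => cel (- h) e.1 e.2) (y := (e, k))) => //.
  by rewrite mem_enum.
apply: (@sub_finite_set _ _ [set` s]); last exact: finite_seq.
move=> z [[e [k [_ ->]]]|[mb [r [Rr ->]]]].
  by rewrite -oppr0; apply: sP; rewrite inE eqxx.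
by apply: sP; rewrite inE (hsP Rr) orbT.
Qed.

Lemma unmarkedP k : unmarked k \/ exists mb, k = marker mb.
Proof.
case: (pselect (exists mb, k = marker mb)) => [|nk]; [by right|left=> mb kE].
by apply: nk; exists mb.
Qed.

Lemma unmarked_snd (k : label) : k.2 != 0 -> unmarked k.
Proof. by move=> k2 mb kE; rewrite kE eqxx in k2. Qed.

Lemma tile_neq0 : tile !=set0.
Proof.
by exists (cel 0 0 (0, 1)); left; exists 0, (0, 1); split=> //; exact: unmarked_snd.
Qed.

Lemma tile_tiles f : solves f -> tiles tile.
Proof.
move=> solf; exists [set cel g (f g) 0 | g in setT] => z.
have [g [s [k ->]]] := cel_surj z.
case: (unmarkedP k) => [uk|[[m b] ->]].
  exists (cel g (f g) 0, cel 0 (s - f g) k); split=> [|[a z'] /= [[g' _ <-]]].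
    split=> /=; first by exists g.
      by left; exists (s - f g), k.
    by rewrite celD addr0 add0r addrC subrK.
  move=> [[e [k' [uk' ->]]]|[mb [r [Rr ->]]]]; rewrite celD => /cel_inj[].
    by rewrite addr0 add0r => -> <- ->; rewrite addrC addKr.
  by rewrite add0r => _ _ /esym/uk.
have [r [[Rr fr] rU]] := solf m g s.
exists (cel (g + r.1) (f (g + r.1)) 0, cel (- r.1) r.2 (marker (m, b))).
split=> [|[a z'] /= [[g' _ <-]]].
  split=> /=; first by exists (g + r.1).
    by right; exists (m, b), r.
  by rewrite celD addrK fr add0r.
move=> [[e [k' [uk' ->]]]|[mb [r' [Rr' ->]]]]; rewrite celD => /cel_inj[].
  by rewrite add0r => _ _ /uk'.
rewrite add0r => gE sE /marker_inj mbE; rewrite mbE in Rr' *.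
have g'E : g' = g + r'.1 by rewrite -gE subrK.
have rE : r = r' by apply: rU; rewrite -g'E.
by rewrite g'E rE.
Qed.

Section Rigidity.
Variable A : set cell.
Hypothesis dA : direct_sum_decomposition A tile.

Lemma dA_uniq a a' z z' : A a -> A a' -> tile z -> tile z' -> a + z = a' + z' ->
  a = a' /\ z = z'.
Proof.
move=> Aa Aa' tz tz' E; have [p [_ pU]] := dA (a + z).
have e1 := pU (a, z) (And3 Aa tz erefl).
have e2 := pU (a', z') (And3 Aa' tz' (esym E)).
by move: e2; rewrite e1 => -[-> ->].
Qed.

(* Two tiles over the same base point overlap in an unmarked layer. *)
Lemma graph_uniq g s k s' k' : A (cel g s k) -> A (cel g s' k') -> s = s' /\ k = k'.
Proof.
move=> Aa Aa'.
(* Two values of [c] are excluded and at least three exist. A nonzero second component guarantees an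
   unmarked label. *)
have [c c0 ck] : exists2 c : 'I_(size hs).+3, c != 0 & c + (k.2 - k'.2) != 0.
  have [/eqP d1|d1] := boolP (1 + (k.2 - k'.2) == 0); last by exists 1.
  exists (1 + 1) => //; rewrite -addrA d1 addr0.
  by [].
have [| | |E _] := dA_uniq Aa Aa' (z := cel 0 0 (0, c))
    (z' := cel 0 (s - s') ((0, c) + (k - k'))).
- by left; exists 0, (0, c); split=> //; exact: unmarked_snd.
- left; exists (s - s'), ((0, c) + (k - k')); split=> //.
  exact: unmarked_snd.
- by rewrite !celD !addr0 (addrC s') subrK (addrC k') -addrA subrK addrC.
by case/cel_inj: E.
Qed.

(** If no tile sat over [g], each cell [cel g 0 (0, c)] would be covered by a marked piece of a tile
    over some [g + h] with [h] in [hs], whose label has second component [c]. Each [h] serves one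
    [c] only, and there are more values of [c] than elements of [hs]. *)
Lemma graph_ex g : exists s k, A (cel g s k).
Proof.
apply: contrapT => nA.
have /choice[K KP] (h : G) : exists c : 'I_(size hs).+3,
    forall s k, A (cel (g + h) s k) -> k.2 = c.
  case: (pselect (exists s k, A (cel (g + h) s k))) => [[s [k Ak]]|nk].
    by exists k.2 => s' k' /(graph_uniq Ak)[_ ->].
  by exists 0 => s k Ak; case: nk; exists s, k.
suff: (size (enum 'I_(size hs).+3) <= size [seq K h | h <- hs])%N.
  by rewrite size_map size_enum_ord; lia.
apply: uniq_leq_size; first exact: enum_uniq.
move=> c _; apply/mapP.
have [[a z] [[/= Aa tz E] _]] := dA (cel g 0 (0, c)).
have [g' [s' [k' aE]]] := cel_surj a; rewrite {a}aE in Aa E.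
case: tz E => [[e [k'' [uk ->]]]|[mb [r [Rr ->]]]]; rewrite celD => /cel_inj[].
  by rewrite addr0 => gE; case: nA; exists s', k'; rewrite -gE.
move=> gE _ /(congr1 snd)/= kE; exists r.1; first exact: (hsP Rr).
rewrite -(KP _ s' k'); first by rewrite -kE addr0.
by rewrite -gE subrK.
Qed.

Lemma marker_const g s k g' s' k' m r :
  A (cel g s k) -> A (cel g' s' k') -> R m r -> g' = g + r.1 -> k' = k.
Proof.
move=> Aa Aa' Rr gE; apply/eqP; rewrite -subr_eq0; apply/eqP.
(* Over an unmarked label the full fibre of the tile at [g] would meet the piece [R m] of the tile
   at [g']. *)
have marked b : exists c, k' - k + marker (m, b) = marker c.
  case: (unmarkedP (k' - k + marker (m, b))) => // uk.
  have [| | |_] := dA_uniq Aa Aa'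
      (z := cel 0 (s' + r.2 - s) (k' - k + marker (m, b)))
      (z' := cel (- r.1) r.2 (marker (m, b))).
  - by left; exists (s' + r.2 - s), (k' - k + marker (m, b)).
  - by right; exists (m, b), r.
  - by rewrite !celD addr0 gE addrK addrC subrK addrA (addrC k) subrK.
  by case/cel_inj=> _ _ /uk.
have [[c cE] [d dE]] := (marked true, marked false).
by apply: (marker_sidon _ cE dE); rewrite xpair_eqE andbF.
Qed.

(** The labels [k] may vary over [G], but they agree at points related by an equation, so the layer
    [k g + marker (m, true)] over [g] reads equation [m]. *)
Lemma graph_solves f (k : G -> label) : (forall g, A (cel g (f g) (k g))) -> solves f.
Proof.
move=> Af m g s.
have kr r g' : R m r -> g' = g + r.1 -> k g' = k g.
  by move=> Rr; exact: marker_const (Af g) (Af g') Rr.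
have tr r : R m r -> tile (cel (- r.1) r.2 (marker (m, true))).
  by move=> Rr; right; exists (m, true), r.
have [[a z] [[/= Aa tz E] _]] := dA (cel g s (k g + marker (m, true))).
have [g' [s' [k' aE]]] := cel_surj a; rewrite {a}aE in Aa E.
have [? ?] := graph_uniq Aa (Af g'); subst s' k'.
case: tz E => [[e [k'' [uk ->]]]|[[m' b] [r [/= Rr ->]]]]; rewrite celD => /cel_inj[].
  by rewrite addr0 => -> _ /addrI/uk.
move=> gE sE kE.
have g'E : g' = g + r.1 by rewrite -gE subrK.
have kgE : k g' = k g by exact: marker_const (Af g) (Af g') Rr g'E.
move: kE; rewrite kgE => /addrI/marker_inj[? ?]; subst m' b.
exists r; split=> [|r' [Rr' fr']]; first by rewrite -g'E.
have [|_] := dA_uniq (Af g') (Af (g + r'.1)) (tr _ Rr) (tr _ Rr').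
  by rewrite !celD addrK sE fr' gE kgE (kr _ _ Rr' erefl).
by case/cel_inj=> /oppr_inj e1 e2 _; case: (r) (r') e1 e2 => [? ?] [? ?] /= -> ->.
Qed.

End Rigidity.

Lemma cel0 : cel 0 0 0 = 0.
Proof. by apply: (addIr (cel 0 0 0)); rewrite celD !addr0 add0r. Qed.

Lemma cel_mulrn h n : cel h 0 0 *+ n = cel (h *+ n) 0 0.
Proof.
by elim: n => [|n IH]; rewrite ?mulr0n ?cel0 // !mulrS IH celD !addr0.
Qed.

Lemma periodic_tile_solution :
  periodically_tiles tile -> exists2 f, solves f & periodic_fun f.
Proof.
move=> [A [L [sL fL [Z _ AE]]] dA].
have /choice[sk Af] g : exists sk, A (cel g sk.1 sk.2).
  by have [s [k Ak]] := graph_ex dA g; exists (s, k).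
exists (fst \o sk) => [|h]; first exact: graph_solves dA _ _ Af.
have [n n0 Ln] := finite_index_multiple (cel h 0 0) sL fL.
exists n => // g /=; have [L0 LB] := (subgroupE L).1 sL.
have Agn : A (cel (g + h *+ n) (sk g).1 (sk g).2).
  have -> : cel (g + h *+ n) (sk g).1 (sk g).2 =
            cel g (sk g).1 (sk g).2 + cel h 0 0 *+ n.
    by rewrite cel_mulrn celD !addr0.
  have := Af g; rewrite AE => -[c Zc [l Ll <-]]; exists c => //.
  exists (l + cel h 0 0 *+ n); last by rewrite addrA.
  by have := LB _ _ Ll (LB _ _ L0 Ln); rewrite sub0r opprK.
by have [] := graph_uniq dA (Af (g + h *+ n)) Agn.
Qed.
End SystemToTile.

Lemma aperiodic_tile (C H : finZmodType) (M : finType)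
    (R : M -> set (int * int * C * H)) :
    (forall m, finite_set (R m)) ->
    (exists f, solves R f) -> (forall f, solves R f -> ~ periodic_fun f) ->
  exists (G0 : finZmodType) (F : set (int * int * G0)%type),
    [/\ finite_set F, F !=set0, tiles F & ~ periodically_tiles F].
Proof.
move=> finR [f solf] nper; have [hs hsP] := supportP finR.
pose K : finZmodType := (C * H * label M hs)%type.
pose cel (g : int * int * C) s k : int * int * K := (g.1, (g.2, s, k)).
have cel_surj z : exists g s k, z = cel g s k.
  by case: z => xy [[c s] k]; exists (xy, c), s, k.
have celD g s k g' s' k' : cel g s k + cel g' s' k' = cel (g + g') (s + s') (k + k').
  by [].
have cel_inj g s k g' s' k' :
    cel g s k = cel g' s' k' -> [/\ g = g', s = s' & k = k'].
  by case: g g' => [xy c] [xy' c'] [-> -> -> ->].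
exists K, (tile R cel); split.
- exact: tile_finite.
- exact: tile_neq0.
- exact: tile_tiles cel_surj celD cel_inj _ solf.
- by case/(periodic_tile_solution hsP cel_surj celD cel_inj) => f' /nper.
Qed.
(** An explicit list, over which finite quantifiers are decided by [vm_compute]. *)
Definition residues n : seq 'I_n.+1 := [seq inZp k | k <- iota 0 n.+1].

Lemma mem_residues n (x : 'I_n.+1) : x \in residues n.
Proof.
by apply/mapP; exists (val x); rewrite ?mem_iota ?valZpK //=.
Qed.

Lemma residues2P n (P : 'I_n.+1 -> 'I_n.+1 -> bool) :
  all (fun a => all (P a) (residues n)) (residues n) -> forall a b, P a b.
Proof.
move=> /allP PP a b.
exact: (allP (PP a (mem_residues a)) b (mem_residues b)).
Qed.

Lemma int_shift_ind (P : int -> Prop) :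
  (forall n, P n <-> P (n + 1)) -> P 0 -> forall n, P n.
Proof.
move=> PS P0; elim=> [|n IH|n IH] //.
  by rewrite -addn1 PoszD; apply: (PS _).1.
by apply: (PS _).2; rewrite -addn1 PoszD opprD subrK.
Qed.

(** * Pairs of consecutive elements of Z/4 over the base group *)

Notation G4 := (int * int * (bool * bool))%type.
Notation Z4 := 'I_4.

Definition e1 : G4 := (1, 0, (false, false)).
Definition e2 : G4 := (0, 1, (false, false)).
(** [flip] exchanges the two elements of a pair, [swap] the two copies of the plane. *)
Definition flip : G4 := (0, 0, (true, false)).
Definition swap : G4 := (0, 0, (false, true)).
(** The step [0] makes each pair consecutive and the others transport it; along [flip] a pair is
    merely reversed. *)
Definition steps : seq G4 := [:: 0; e1; e2; swap].

Lemma G4D x y t s x' y' t' s' :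
  (x, y, (t, s)) + (x', y', (t', s')) =
  (x + x', y + y', (t (+) t', s (+) s')) :> G4.
Proof. by []. Qed.

Lemma G4_ind (P : G4 -> Prop) :
  (forall h, h \in [:: e1; e2; swap; flip] -> forall g, P g <-> P (g + h)) ->
  forall g, P 0 -> P g.
Proof.
move=> Ph [[x y] [t s]] P0.
have Px : P (x, 0, (false, false)).
  by elim/int_shift_ind: x => // x; rewrite (Ph e1) ?inE // G4D.
have Py : P (x, y, (false, false)).
  by elim/int_shift_ind: y => // y; rewrite (Ph e2) ?inE // G4D addr0.
have Ps : P (x, y, (false, s)).
  by case: s => //; move: Py; rewrite (Ph swap) ?inE // G4D !addr0.
case: t => //; move: Ps; rewrite (Ph flip) ?inE // G4D !addr0 addbF; exact.
Qed.
Definition opposite_pair (a v w : Z4) :=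
  [|| (v == a) && (w == a + 1) | (v == a + 1) && (w == a)].

(** By counting, {c, d} + 2 is then the complement of {a, b}. A pair related to itself in this way
    is consecutive, and two related consecutive pairs coincide. *)
Definition covers (a b c d : Z4) :=
  all (fun z => z \in [:: a; b; c + inZp 2; d + inZp 2]) (residues 3).

Lemma covers_self a b :
  covers a b a b -> opposite_pair a a b || opposite_pair b a b.
Proof.
move: a b; suff H a b : covers a b a b ==> (opposite_pair a a b || opposite_pair b a b).
  by move=> a b; apply/implyP.
by move: a b; apply: residues2P; vm_compute.
Qed.

Lemma covers_opposite x y a b c d :
  opposite_pair x a b -> opposite_pair y c d -> covers a b c d -> x = y.
Proof.
have H (u t : Z4) : all (fun p : Z4 * Z4 => all (fun q : Z4 * Z4 =>
    covers p.1 p.2 q.1 q.2 ==> (u == t)) [:: (t, t + 1); (t + 1, t)])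
    [:: (u, u + 1); (u + 1, u)].
  by move: u t; apply: residues2P; vm_compute.
move=> pab pcd cov; apply/eqP; apply: (implyP _ cov).
apply: (allP (allP (H x y) (a, b) _) (c, d)); rewrite !inE !xpair_eqE.
  by case/orP: pab => ->; rewrite ?orbT.
by case/orP: pcd => ->; rewrite ?orbT.
Qed.

Lemma opposite_pair_partition a v w v' w' z :
  opposite_pair a v w -> opposite_pair a v' w' ->
  ((z == v) + (z == w) + (z == (v' + inZp 2)%R) + (z == (w' + inZp 2)%R) = 1)%N.
Proof.
have H (u t : Z4) : all (fun p : Z4 * Z4 => all (fun q : Z4 * Z4 =>
    ((t == p.1) + (t == p.2) + (t == (q.1 + inZp 2)%R) + (t == (q.2 + inZp 2)%R) == 1)%N)
    [:: (u, u + 1); (u + 1, u)]) [:: (u, u + 1); (u + 1, u)].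
  by move: u t; apply: residues2P; vm_compute.
move=> p q; apply/eqP; apply: (allP (allP (H a z) (v, w) _) (v', w')).
  by rewrite !inE !xpair_eqE.
by rewrite !inE !xpair_eqE.
Qed.

Lemma opposite_pairC a v w : opposite_pair a v w = opposite_pair a w v.
Proof. by rewrite /opposite_pair orbC; congr (_ || _); rewrite andbC. Qed.

Lemma flip2 (g : G4) : g + flip + flip = g.
Proof. by case: g => [[x y] [t s]]; rewrite !G4D !addr0 !addbF -addbA addbb addbF. Qed.

(** * Equations with values in Z/4 *)

Section Equations.
Variable I : finType.
Notation H := {ffun I -> Z4}.

(* [f] solves this equation iff its [i]-th coordinate is invariant under [h]. *)
Definition shift_eq (i : I) (h : G4) : set (G4 * H) := [set r : G4 * H |
  (r.1 = 0 /\ r.2 i == 0) \/ (r.1 = h /\ r.2 i != 0)].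

(* Solving this for all [h] in [steps] amounts to: for some constant [a],
   [{phi (f g), phi (f (g + flip))} = {a, a + 1}] for all [g]. *)
Definition complement_eq (phi : H -> Z4) (h : G4) : set (G4 * H) := [set r : G4 * H |
  ((r.1 = 0 \/ r.1 = flip) /\ phi r.2 = 0) \/
  ((r.1 = h \/ r.1 = h + flip) /\ phi r.2 = inZp 2)].

Definition solves1 (R : set (G4 * H)) (f : G4 -> H) :=
  forall g s, exists! r : G4 * H, R r /\ f (g + r.1) + r.2 = s.

Lemma solves1P R f : (forall g s, exists! h, R (h, s - f (g + h))) -> solves1 R f.
Proof.
move=> ex g s; have [h [Rh hU]] := ex g s; exists (h, s - f (g + h)).
split=> [|[h' e] /= [Rr fs]]; first by rewrite /= subrKC.
have eE : e = s - f (g + h') by rewrite -fs addrC addKr.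
by rewrite -(hU h') -?eE // eE -(hU h') // -eE.
Qed.

Lemma finite_eq (R : set (G4 * H)) (hs : seq G4) :
  (forall r, R r -> r.1 \in hs) -> finite_set R.
Proof.
move=> Rhs; apply: (@sub_finite_set _ _
  [set` [seq (h, e) | h <- hs, e <- enum {: H}]]); last exact: finite_seq.
move=> [h e] /Rhs /= hhs; rewrite /mkset.
by apply: allpairs_f; rewrite ?mem_enum.
Qed.

Lemma shift_eq_finite i h : finite_set (shift_eq i h).
Proof.
by apply: (@finite_eq _ [:: 0; h]) => r [[-> _]|[-> _]]; rewrite !inE eqxx ?orbT.
Qed.

Lemma complement_eq_finite phi h : finite_set (complement_eq phi h).
Proof.
apply: (@finite_eq _ [:: 0; flip; h; h + flip]) => r.
by move=> [[[]-> _]|[[]-> _]]; rewrite !inE eqxx ?orbT.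
Qed.

(** At the target [s = f g] the shift [0] always gives a representation; a change of the [i]-th
    coordinate along [h] would give a second one. *)
Lemma solves_shift_eq i (h : G4) f : h != 0 ->
  solves1 (shift_eq i h) f <-> forall g, f (g + h) i = f g i.
Proof.
move=> h0; split=> [sol g|fh].
  have := sol g (f g); rewrite /shift_eq => -[[h' e] [/= [Rr fr] U]].
  have {}U (k : G4) (e' : H) : k = 0 /\ e' i == 0 \/ k = h /\ e' i != 0 ->
    f (g + k) + e' = f g -> k = 0.
    move=> A B; have := U (k, e') (conj A B).
    have := U (0, 0); rewrite addr0 /= ffunE eqxx addr0 => U0.
    by rewrite U0; [case|split=> //; left].
  have := U h (f g - f (g + h)); rewrite subrKC => {}U.
  apply/eqP/negP => /negP ne; move/eqP: h0; apply; apply: U => //.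
  by right; split=> //; rewrite !ffunE subr_eq0 eq_sym.
apply: solves1P => g s.
have [E|E] := eqVneq (s i) (f g i).
  exists 0; split; first by left; rewrite addr0 !ffunE E subrr.
  by move=> h'; rewrite /shift_eq /= => -[[-> //]|[->]]; rewrite !ffunE fh E subrr.
exists h; split; first by right; rewrite !ffunE fh subr_eq0.
by move=> h'; rewrite /shift_eq /= => -[[->]|[-> //]];
  rewrite !ffunE addr0 subr_eq0 (negPf E).
Qed.

Section Pair.
Variable phi : H -> Z4.
Hypothesis phiB : forall s s', phi (s - s') = phi s - phi s'.
Hypothesis phi_surj : forall z, exists s, phi s = z.

Lemma solves_pair_covers f h g : solves1 (complement_eq phi h) f ->
  covers (phi (f g)) (phi (f (g + flip))) (phi (f (g + h))) (phi (f (g + h + flip))).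
Proof.
move=> sol; apply/allP => z _; have [s <-] := phi_surj z.
have [[h' e] [[/= Rr E] _]] := sol g s.
have eE : e = s - f (g + h') by rewrite -E addrC addKr.
move: Rr; rewrite eE /complement_eq /= phiB => -[[hE /eqP]|[hE /eqP]].
  by rewrite subr_eq add0r !inE; case: hE => -> /eqP ->; rewrite ?addr0 eqxx ?orbT.
rewrite subr_eq addrC !inE; case: hE => -> /eqP ->;
by rewrite ?addrA eqxx ?orbT.
Qed.

Lemma pair_constant f : (forall h, h \in steps -> solves1 (complement_eq phi h) f) ->
  exists a, forall g, opposite_pair a (phi (f g)) (phi (f (g + flip))).
Proof.
move=> sol; pose v g := phi (f g).
have cov g h : h \in steps -> covers (v g) (v (g + flip)) (v (g + h)) (v (g + h + flip)).
  by move=> hst; apply: solves_pair_covers; apply: sol.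
have ex g : exists a, opposite_pair a (v g) (v (g + flip)).
  have := cov g 0; rewrite inE eqxx addr0 => /(_ isT) /covers_self.
  by case/orP=> ?; [exists (v g)|exists (v (g + flip))].
have [a Pa] := ex 0.
exists a => g; move: Pa.
apply: (@G4_ind (fun g => opposite_pair a (v g) (v (g + flip)))) => // h hst {}g.
have [hf|hs] : h = flip \/ h \in steps.
- have [->|ne] := eqVneq h flip; first by left.
  by right; move: hst; rewrite !inE (negPf ne) orbF => ->; rewrite orbT.
- by rewrite hf flip2 opposite_pairC.
have [b Pb] := ex g; have [c Pc] := ex (g + h).
split=> P0; first by rewrite (covers_opposite P0 Pc (cov _ _ hs)).
by rewrite -(covers_opposite Pb P0 (cov _ _ hs)).
Qed.

Lemma pair_solves f a h :
  (forall g, opposite_pair a (phi (f g)) (phi (f (g + flip)))) ->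
  solves1 (complement_eq phi h) f.
Proof.
move=> fa; apply: solves1P => g s.
have := opposite_pair_partition (phi s) (fa g) (fa (g + h)); rewrite -addrA.
have RE h' : complement_eq phi h (h', s - f (g + h')) <->
    ((h' = 0 \/ h' = flip) /\ phi s == phi (f (g + h'))) \/
    ((h' = h \/ h' = h + flip) /\ phi s == phi (f (g + h')) + inZp 2).
  rewrite /complement_eq /= phiB.
  have -> : (phi s - phi (f (g + h')) = 0) <-> (phi s == phi (f (g + h'))).
    by rewrite -subr_eq0; split=> /eqP.
  have -> // : (phi s - phi (f (g + h')) = inZp 2) <->
    (phi s == phi (f (g + h')) + inZp 2).
  by rewrite (addrC (phi (f _))) -subr_eq; split=> /eqP.
move=> S; have one : [|| phi s == phi (f g), phi s == phi (f (g + flip)),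
    phi s == phi (f (g + h)) + inZp 2 | phi s == phi (f (g + (h + flip))) + inZp 2].
  by move: S; do 4![case: (phi s == _)].
case/or4P: one => z.
- exists 0; split=> [|h' /RE]; first by apply/RE; rewrite addr0; left; split=> //; left.
  by move=> [[[]->]|[[]->]] // e; move: S; rewrite z e //; do 2!case: (_ == _).
- exists flip; split=> [|h' /RE]; first by apply/RE; left; split=> //; right.
  by move=> [[[]->]|[[]->]]; rewrite ?addr0 // => e; move: S; rewrite z e;
    do 2!case: (_ == _).
- exists h; split=> [|h' /RE]; first by apply/RE; right; split=> //; left.
  by move=> [[[]->]|[[]->]]; rewrite ?addr0 // => e; move: S; rewrite z e;
    do 2!case: (_ == _).
- exists (h + flip); split=> [|h' /RE]; first by apply/RE; right; split=> //; right.
  by move=> [[[]->]|[[]->]]; rewrite ?addr0 // => e; move: S; rewrite z e;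
    do 2!case: (_ == _).
Qed.
End Pair.
End Equations.

(** * Sums of three bits in Z/4 *)

Definition nat_bit (b : bool) : Z4 := inZp b.

Lemma nat_bit0 : nat_bit false = 0. Proof. exact: val_inj. Qed.
Lemma nat_bit1 : nat_bit true = 1. Proof. exact: val_inj. Qed.

Definition triple_sum (c : Z4) (l : bool * bool * bool) : Z4 :=
  c + (nat_bit l.1.1 + nat_bit l.1.2 + nat_bit l.2).

Definition same3 (l : bool * bool * bool) := (l.1.1 == l.1.2) && (l.1.1 == l.2).

Definition neg3 (l : bool * bool * bool) := (~~ l.1.1, ~~ l.1.2, ~~ l.2).

(** Negating three bits turns their sum k into 3 - k. Equal bits give the pair {3, 0}, the others
    {1, 2}: both are consecutive in Z/4, and they are distinct, so the base [b] tells the cases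
    apart. *)
Lemma same3_constant c b l l' :
  opposite_pair b (triple_sum c l) (triple_sum c (neg3 l)) ->
  opposite_pair b (triple_sum c l') (triple_sum c (neg3 l')) -> same3 l = same3 l'.
Proof.
pose bs := [:: true; false].
have bsP (x : bool) : x \in bs by case: x.
pose ok l := opposite_pair b (triple_sum c l) (triple_sum c (neg3 l)).
have : all (fun x => all (fun y => all (fun z => all (fun x' => all (fun y' =>
    all (fun z' => [&& ok (x, y, z) & ok (x', y', z')] ==>
      (same3 (x, y, z) == same3 (x', y', z'))) bs) bs) bs) bs) bs) bs.
  by rewrite {}/ok; move: c b; apply: residues2P; vm_compute.
case: l l' => [[x y] z] [[x' y'] z'] H p q; apply/eqP.
move/allP/(_ _ (bsP x))/allP/(_ _ (bsP y))/allP/(_ _ (bsP z)): H.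
move/allP/(_ _ (bsP x'))/allP/(_ _ (bsP y'))/allP/(_ _ (bsP z'))/implyP; apply.
exact/andP.
Qed.

Lemma opposite_pair_bit a v w : opposite_pair a v w ->
  v = a + nat_bit (v != a) /\ (w != a) = ~~ (v != a).
Proof.
have ne (x : Z4) : x + 1 != x by rewrite addrC -subr_eq0 addrK.
case/orP=> /andP[/eqP -> /eqP ->]; by rewrite eqxx ne ?nat_bit0 ?nat_bit1 ?addr0.
Qed.

Lemma opposite_pair_bits a (b : bool) :
  opposite_pair a (a + nat_bit b) (a + nat_bit (~~ b)).
Proof. by rewrite /opposite_pair; case: b; rewrite nat_bit0 nat_bit1 addr0 !eqxx ?orbT. Qed.

Lemma opposite_pair_triple c l : ~~ same3 l ->
  opposite_pair (c + 1) (triple_sum c l) (triple_sum c (neg3 l)).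
Proof.
rewrite /opposite_pair /triple_sum -[c + 1 + 1]addrA.
have E x y : (c + x == c + y) = (x == y) by exact: (inj_eq (addrI c)).
by rewrite !E; case: l => [[[] []] []].
Qed.

(** * Systems of not-all-equal clauses *)

Section NaeSystem.
Variable I : finType.
Notation H := {ffun I -> Z4}.
Notation literal := (I * bool)%type.
Notation clause := (literal * literal * literal)%type.
Variables (invs : seq (I * G4)) (cls : seq clause).
Hypothesis invs_neq0 : forall r, r \in invs -> r.2 != 0.
Hypothesis cls_distinct : forall c, c \in cls ->
  (c.1.1.1 != c.1.2.1) && (c.1.1.1 != c.2.1).

Definition lit (e : {ffun I -> bool}) (l : literal) := e l.1 (+) l.2.

Definition all_same e (c : clause) :=
  (lit e c.1.1 == lit e c.1.2) && (lit e c.1.1 == lit e c.2).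

Definition bit_system (e : G4 -> {ffun I -> bool}) :=
  (forall g i, e (g + flip) i = ~~ e g i) /\
  (forall r, r \in invs -> forall g, e (g + r.2) r.1 = e g r.1).

Definition signed (s : H) (l : literal) : Z4 := if l.2 then - s l.1 else s l.1.

Definition form (F : I + seq_sub cls) (s : H) : Z4 :=
  match F with
  | inl i => s i
  | inr c => let c := val c in signed s c.1.1 + signed s c.1.2 + signed s c.2
  end.

Lemma signedB s s' l : signed (s - s') l = signed s l - signed s' l.
Proof. by rewrite /signed; case: l.2; rewrite !ffunE // opprD. Qed.

Lemma formB F s s' : form F (s - s') = form F s - form F s'.
Proof.
case: F => [i|c] /=; first by rewrite !ffunE.
by rewrite !signedB !opprD [RHS]addrACA; congr (_ + _); rewrite addrACA.
Qed.

Lemma form_surj F z : exists s, form F s = z.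
Proof.
case: F => [i|[c cP]]; first by exists [ffun=> z]; rewrite /= ffunE.
have /andP[n2 n3] := cls_distinct cP.
exists [ffun i => if i == c.1.1.1 then (if c.1.1.2 then - z else z) else 0].
rewrite /= /signed !ffunE eqxx (eq_sym c.1.2.1) (negPf n2) (eq_sym c.2.1) (negPf n3).
by rewrite oppr0 !if_same !addr0; case: c.1.1.2; rewrite ?opprK.
Qed.

Definition eq_index : finType :=
  (seq_sub invs + (I + seq_sub cls) * seq_sub steps)%type.

Definition eqs (m : eq_index) : set (G4 * H) :=
  match m with
  | inl r => shift_eq (val r).1 (val r).2
  | inr (F, h) => complement_eq (form F) (val h)
  end.

Lemma solves_eqs f : solves eqs f ->
  (forall r, r \in invs -> forall g, f (g + r.2) r.1 = f g r.1) /\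
  (forall F, exists a, forall g,
     opposite_pair a (form F (f g)) (form F (f (g + flip)))).
Proof.
move=> sol; split=> [r rP|F].
  exact: ((solves_shift_eq _ _ (invs_neq0 rP)).1 (sol (inl (SeqSub rP)))).
apply: pair_constant (formB F) (form_surj F) _ _ => h hP.
exact: (sol (inr (F, SeqSub hP))).
Qed.

Section BitsOf.
Variables (f : G4 -> H) (a : I -> Z4).
Hypothesis fa : forall i g, opposite_pair (a i) (f g i) (f (g + flip) i).

Definition bits_of g : {ffun I -> bool} := [ffun i => f g i != a i].

Lemma bits_of_flip g i : bits_of (g + flip) i = ~~ bits_of g i.
Proof. by rewrite !ffunE; have [] := opposite_pair_bit (fa i g). Qed.

(* A signed literal contributes a constant plus its truth value. *)
Definition offset (l : literal) : Z4 := if l.2 then - a l.1 - 1 else a l.1.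

(** For a negated literal, -(a + b) = (-a - 1) + (1 - b). *)
Lemma signed_bits g l : signed (f g) l = offset l + nat_bit (lit (bits_of g) l).
Proof.
rewrite /signed /offset /lit ffunE; have [fE _] := opposite_pair_bit (fa l.1 g).
set b := _ != _ in fE *; rewrite fE; case: l.2; rewrite ?addbF // addbT opprD -addrA.
by congr (_ + _); case: b {fE}; rewrite nat_bit0 nat_bit1 ?addr0 // addNr oppr0.
Qed.

Definition truth g (c : clause) :=
  (lit (bits_of g) c.1.1, lit (bits_of g) c.1.2, lit (bits_of g) c.2).

Lemma truth_flip g c : truth (g + flip) c = neg3 (truth g c).
Proof. by rewrite /truth /lit !bits_of_flip !addNb. Qed.

Lemma form_bits g c : form (inr c) (f g) =
  triple_sum (offset (val c).1.1 + offset (val c).1.2 + offset (val c).2)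
             (truth g (val c)).
Proof.
rewrite /= !signed_bits /triple_sum /=.
by rewrite [RHS]addrACA; congr (_ + _); rewrite addrACA.
Qed.
End BitsOf.

(** The tile only enforces that each clause is everywhere or nowhere all-same; aperiodicity is
    therefore asked of this weak form, existence of the strong one. *)
Lemma aperiodic_tile_of_bits :
  (exists2 e, bit_system e & forall c, c \in cls -> forall g, ~~ all_same (e g) c) ->
  (forall e, bit_system e ->
     (forall c, c \in cls -> forall g g', all_same (e g) c = all_same (e g') c) ->
     ~ periodic_fun e) ->
  exists (G0 : finZmodType) (F : set (int * int * G0)%type),
    [/\ finite_set F, F !=set0, tiles F & ~ periodically_tiles F].
Proof.
move=> [e [eflip einv] eN] nper; apply: (@aperiodic_tile _ _ _ eqs).
- case=> [r|[F h]]; [exact: shift_eq_finite|exact: complement_eq_finite].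
- pose f g : H := [ffun i => nat_bit (e g i)].
  pose a0 : I -> Z4 := fun=> 0.
  have fa i g : opposite_pair (a0 i) (f g i) (f (g + flip) i).
    by rewrite !ffunE eflip -[nat_bit _]add0r -[nat_bit (~~ _)]add0r opposite_pair_bits.
  have fe g : bits_of f a0 g = e g.
    by apply/ffunP=> i; rewrite !ffunE; case: (e g i).
  exists f => -[r|[F h]].
    apply: (solves_shift_eq _ _ (invs_neq0 (valP r))).2.
    by move=> g; rewrite !ffunE einv // (valP r).
  have [a Fa] : exists a, forall g,
      opposite_pair a (form F (f g)) (form F (f (g + flip))).
    case: F => [i|c]; first by exists (a0 i) => g; exact: fa.
    eexists => g; rewrite !(form_bits fa) (truth_flip fa).
    by apply: opposite_pair_triple; rewrite /truth fe; apply: eN; exact: valP c.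
  exact: (pair_solves (formB F) (val h) Fa).
- move=> f /solves_eqs[finv fpair] per.
  have /choice[a fa] i : exists a, forall g, opposite_pair a (f g i) (f (g + flip) i).
    by have [a fa] := fpair (inl i); exists a.
  apply: (nper (bits_of f a)).
  + split=> [g i|r rP g]; first exact: bits_of_flip.
    by rewrite !ffunE finv.
  + move=> c cP g g'; have [b fb] := fpair (inr (SeqSub cP)).
    have := fb g; have := fb g'; rewrite !(form_bits fa) !(truth_flip fa) => p q.
    exact: same3_constant q p.
  + move=> h; have [n n0 fn] := per h; exists n => // g.
    by apply/ffunP=> i; rewrite !ffunE fn.
Qed.
End NaeSystem.
(** * Arbitrary finite rules *)

Lemma boolD (a b : bool) : a + b = a (+) b. Proof. by []. Qed.

Section Colouring.
Variables (V : finType) (Omega : pred {ffun V -> bool}).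
Variable W : seq (V * (int * int) * bool).
Hypothesis W_neq0 : forall w, w \in W -> w.1.2 != 0.

(** The bit [w.2] admits antiperiods, realised in [var_invs] by adding [flip] to the vector; a
    parity will need one. *)
Definition colouring (al : int * int -> {ffun V -> bool}) :=
  (forall x, Omega (al x)) /\
  (forall w, w \in W -> forall x, al (x + w.1.2) w.1.1 = al x w.1.1 (+) w.2).

Notation pattern := {ffun V -> bool}.
Definition var : finType := (bool + V + pattern * 'I_(#|V|).+1)%type.
Definition ref_var : var := inl (inl false).
Definition layer_var : var := inl (inl true).
Definition col_var v : var := inl (inr v).
Definition match_var (om : pattern) j : var := inr (om, j).

(* The swap coordinate distinguishes a layer with [layer_var <> ref_var], where
   [col_var v] carries the colouring and [match_var om j] differs from [ref_var] when
   the first [j] colours agree with [om], from a layer with [layer_var = ref_var],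
   where the pin clauses make every [match_var] differ from [ref_var]. *)
Definition var_invs : seq (var * G4) :=
  [:: (ref_var, e1); (ref_var, e2); (ref_var, swap);
      (layer_var, e1); (layer_var, e2); (layer_var, swap + flip)] ++
  [seq (col_var w.1.1, (w.1.2, (w.2, false))) | w <- W].

(** Where [ref_var] is false and [layer_var] true, the start clause makes the first [match_var]
    true, the step clauses propagate this while the colours agree with [om], and the end clause,
    imposed for forbidden [om], makes the last one false. Where both are false, the pin clauses make
    every [match_var] true and the other clauses then hold by themselves. *)
Definition start_clause om :=
  ((ref_var, false), (layer_var, true), (match_var om ord0, false)).
Definition pin_clause om j :=
  ((ref_var, false), (layer_var, false), (match_var om j, false)).
Definition step_clause (om : pattern) (j : 'I_#|V|) :=
  ((match_var om (widen_ord (leqnSn _) j), true),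
   (col_var (enum_val j), om (enum_val j)),
   (match_var om (lift ord0 j), false)).
Definition end_clause om :=
  ((ref_var, false), (layer_var, true), (match_var om ord_max, true)).

Definition var_cls :=
  [seq start_clause om | om <- enum {: pattern}] ++
  [seq pin_clause om j | om <- enum {: pattern}, j <- enum 'I_(#|V|).+1] ++
  [seq step_clause om j | om <- enum {: pattern}, j <- enum 'I_#|V|] ++
  [seq end_clause om | om <- enum {: pattern} & ~~ Omega om].

Lemma var_clsP c : c \in var_cls ->
  [\/ exists om, c = start_clause om, exists om j, c = pin_clause om j,
      exists om j, c = step_clause om j | exists2 om, ~~ Omega om & c = end_clause om].
Proof.
rewrite !mem_cat => /or4P[/mapP[om _ ->]|/allpairsP[[om j] /= [_ _ ->]]|
  /allpairsP[[om j] /= [_ _ ->]]|/mapP[om + ->]].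
- by apply: Or41; exists om.
- by apply: Or42; exists om, j.
- by apply: Or43; exists om, j.
- by rewrite mem_filter => /andP[nom _]; apply: Or44; exists om.
Qed.

Lemma start_clause_in om : start_clause om \in var_cls.
Proof. by rewrite !mem_cat map_f // mem_enum. Qed.
Lemma pin_clause_in om j : pin_clause om j \in var_cls.
Proof. by rewrite !mem_cat allpairs_f ?orbT // mem_enum. Qed.
Lemma step_clause_in om j : step_clause om j \in var_cls.
Proof. by rewrite !mem_cat (allpairs_f step_clause) ?orbT // mem_enum. Qed.
Lemma end_clause_in om : ~~ Omega om -> end_clause om \in var_cls.
Proof. by move=> nom; rewrite !mem_cat map_f ?orbT // mem_filter nom mem_enum. Qed.

Lemma var_invs_neq0 r : r \in var_invs -> r.2 != 0.
Proof.
rewrite mem_cat => /orP[|/mapP[w wW ->] /=]; last first.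
  by apply: contra (W_neq0 wW) => /eqP[-> _].
by rewrite !inE => /or4P[/eqP->|/eqP->|/eqP->|/or3P[]/eqP->].
Qed.

Lemma var_cls_distinct c : c \in var_cls ->
  (c.1.1.1 != c.1.2.1) && (c.1.1.1 != c.2.1).
Proof.
case/var_clsP => [[om ->]|[om [j ->]]|[om [j ->]]|[om _ ->]] //=.
by apply/eqP=> -[]; rewrite /bump; lia.
Qed.

Section Extension.
Variable al : int * int -> pattern.
Hypothesis al_col : colouring al.

Definition agree x (om : pattern) (j : nat) :=
  [forall k : 'I_#|V|, (k < j)%N ==> (al x (enum_val k) == om (enum_val k))].

Lemma agreeS x om (j : 'I_#|V|) :
  agree x om j.+1 = agree x om j && (al x (enum_val j) == om (enum_val j)).
Proof.
apply/forallP/andP => [H|[/forallP H Hj] k].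
  split; last by have := H j; rewrite ltnSn.
  by apply/forallP=> k; apply/implyP => kj; have := H k; rewrite ltnS (ltnW kj).
by rewrite ltnS leq_eqVlt; case: eqP => [/val_inj ->|_] /=; rewrite ?Hj.
Qed.

Lemma agree_full x om : agree x om #|V| -> al x = om.
Proof.
move/forallP=> H; apply/ffunP=> v.
by have := H (enum_rank v); rewrite ltn_ord enum_rankK => /eqP.
Qed.

Definition layer_bit x (s : bool) (i : var) : bool :=
  match i with
  | inl (inl b) => b && s
  | inl (inr v) => al x v
  | inr (om, j) => ~~ s || agree x om j
  end.

Definition extension (g : G4) : {ffun var -> bool} :=
  [ffun i => g.2.1 (+) layer_bit g.1 g.2.2 i].

Lemma extension_system : bit_system var_invs extension.
Proof.
split=> [[[x y] [t s]] i|r].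
  by rewrite !ffunE G4D !addr0 addbF /= addbT addNb.
rewrite mem_cat => /orP[|/mapP[w wW ->] [x [t s]]]; last first.
  rewrite !ffunE /= al_col.2 //; move: (al x _) w.2 => a b.
  by case: t; case: a; case: b.
by rewrite !inE => /or4P[/eqP->|/eqP->|/eqP->|/or3P[]/eqP->] [[x y] [t s]];
  rewrite !ffunE !G4D /= ?addbF ?addbT //; case: t; case: s.
Qed.

Lemma extension_nae c g : c \in var_cls -> ~~ all_same (extension g) c.
Proof.
rewrite /all_same /lit; case: g => x [t s].
case/var_clsP => [[om ->]|[om [j ->]]|[om [j ->]]|[om nom ->]]; rewrite !ffunE /=.
- have -> : agree x om 0 by apply/forallP.
  by case: t; case: s.
- by case: t; case: s.
- rewrite /bump add1n agreeS.
  case: (agree x om j); case: (al x _) (om _) => [] []; case: t; case: s => //=.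
- have -> : agree x om #|V| = false.
    by apply: contraNF nom => /agree_full <-; exact: al_col.1.
  by case: t; case: s.
Qed.
End Extension.
Section RealLayer.
Variable e : G4 -> {ffun var -> bool}.
Hypothesis e_sys : bit_system var_invs e.
Hypothesis e_weak : forall c, c \in var_cls ->
  forall g g', all_same (e g) c = all_same (e g') c.

Let inv i h : (i, h) \in var_invs -> forall g, e (g + h) i = e g i.
Proof. by move=> ih g; have [_ /(_ _ ih)] := e_sys. Qed.

Lemma ref_bit g : e g ref_var = e 0 ref_var (+) g.2.1.
Proof.
pose P (g : G4) := e g ref_var = e 0 ref_var (+) g.2.1.
apply: (G4_ind (P := P)); last by rewrite /P addbF.
move=> h; rewrite !inE => /or4P[]/eqP -> [[x y] [t s]]; rewrite /P /=.
- by rewrite inv ?inE ?eqxx // !boolD addbF.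
- by rewrite inv ?inE ?eqxx // !boolD addbF.
- by rewrite inv ?inE ?eqxx // !boolD addbF.
- by have [-> _] := e_sys; rewrite !boolD addbT addbN; split=> [->|/negb_inj].
Qed.

Lemma layer_bit_value g : e g layer_var = e 0 layer_var (+) g.2.1 (+) g.2.2.
Proof.
pose P (g : G4) := e g layer_var = e 0 layer_var (+) g.2.1 (+) g.2.2.
apply: (G4_ind (P := P)); last by rewrite /P !addbF.
have eflip g' i : e (g' + flip) i = ~~ e g' i by have [-> _] := e_sys.
move=> h; rewrite !inE => /or4P[]/eqP -> [[x y] [t s]]; rewrite /P /=.
- by rewrite inv ?inE ?eqxx // !boolD !addbF.
- by rewrite inv ?inE ?eqxx // !boolD !addbF.
- have -> : e ((x, y, (t, s)) + swap) layer_var = ~~ e (x, y, (t, s)) layer_var.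
    by rewrite -[LHS]negbK -eflip -addrA inv ?inE ?eqxx ?orbT.
  by rewrite !boolD addbF addbT addbN; split=> [->|/negb_inj].
- by rewrite eflip !boolD addbF addbT addbN addNb; split=> [->|/negb_inj].
Qed.

(** Normalisation: [ref_var] is false at [t0], and there [layer_var] is true exactly on the layer
    [s0]. *)
Let t0 := e 0 ref_var.
Let s0 := ~~ (e 0 layer_var (+) t0).

Definition real_colour (x : int * int) : {ffun V -> bool} :=
  [ffun v => e (x, (t0, s0)) (col_var v)].

Lemma real_ref x s : e (x, (t0, s)) ref_var = false.
Proof. by rewrite ref_bit addbb. Qed.

Lemma real_layer x : e (x, (t0, s0)) layer_var = true.
Proof. by rewrite layer_bit_value /s0 /= addbN addbb. Qed.

Lemma pin_layer x : e (x, (t0, ~~ s0)) layer_var = false.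
Proof. by rewrite layer_bit_value /s0 /= negbK addbb. Qed.

(* A clause which is not constant on one of the two layers is never constant. *)
Lemma real_nae c s s' x : c \in var_cls ->
  ~~ all_same (e (0, (t0, s))) c -> ~~ all_same (e (x, (t0, s'))) c.
Proof. by move=> cP; rewrite (e_weak cP _ (x, (t0, s'))). Qed.

(** The pin clause is not constant on the layer [s0], where [ref_var] and [layer_var] differ; hence
    it is not constant on the other layer, where they agree. *)
Lemma pinned x om j : e (x, (t0, ~~ s0)) (match_var om j) = true.
Proof.
have := @real_nae (pin_clause om j) s0 (~~ s0) x (pin_clause_in om j).
rewrite /all_same /lit /= !real_ref real_layer pin_layer /= addbF => /(_ isT).
by case: (e _ _).
Qed.

(** The start, step and end clauses are satisfied on the pinned layer, hence also on the real one.
    If [real_colour x] were forbidden, they would carry true from its first [match_var] to its last,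
    which must be false. *)
Lemma real_colouring : colouring real_colour.
Proof.
split=> [x|w wW x]; last first.
  rewrite !ffunE; set v := w.1.1.
  (* The invariance moves the flip coordinate by [w.2], which the starting point compensates. *)
  have -> : e (x + w.1.2, (t0, s0)) (col_var v) =
      e ((x, (t0 (+) w.2, s0)) + (w.1.2, (w.2, false))) (col_var v).
    congr (e _ _); case: x => x y; rewrite /v; case: w.1.2 => x' y'.
    by rewrite G4D addbF -addbA addbb addbF.
  rewrite inv; last by rewrite mem_cat; apply/orP; right; apply/mapP; exists w.
  case: w.2; rewrite ?addbF // !addbT -(e_sys.1 _ (col_var v)).
  by congr (e _ _); case: (x) => x1 x2; rewrite G4D !addr0 addbT addbF.
apply: contraT => nom; set om := real_colour x in nom.
pose m j := e (x, (t0, s0)) (match_var om j).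
have m0 : m ord0 = true.
  have := @real_nae (start_clause om) (~~ s0) s0 x (start_clause_in om).
  rewrite /all_same /lit /= !real_ref real_layer pin_layer -/(m ord0) => /(_ isT).
  by case: (m _).
have mmax : m ord_max = false.
  have := @real_nae (end_clause om) (~~ s0) s0 x (end_clause_in nom).
  rewrite /all_same /lit /= !real_ref real_layer pin_layer -/(m ord_max) => /(_ isT).
  by case: (m _).
have mS (j : 'I_#|V|) : m (widen_ord (leqnSn _) j) -> m (lift ord0 j).
  have := @real_nae (step_clause om j) (~~ s0) s0 x (step_clause_in om j).
  rewrite /all_same /lit /= !pinned andbF -!/(m _) => /(_ isT) + mj.
  have -> : e (x, (t0, s0)) (col_var (enum_val j)) (+) om (enum_val j) = false.
    by rewrite ffunE addbb.
  by rewrite mj; case: (m _).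
suff : m ord_max by rewrite mmax.
have M n (nV : (n < #|V|.+1)%N) : m (Ordinal nV).
  elim: n nV => [|n IH] nV; first by rewrite (_ : Ordinal nV = ord0) ?m0 //; exact: val_inj.
  have := mS (Ordinal (nV : (n < #|V|)%N)).
  rewrite (_ : widen_ord _ _ = Ordinal (ltnW nV)); last exact: val_inj.
  by rewrite (_ : lift _ _ = Ordinal nV); [apply|exact: val_inj].
exact: M.
Qed.

Lemma real_periodic : periodic_fun e -> periodic_fun real_colour.
Proof.
move=> per h; have [n n0 en] := per (h, 0); exists n => // x.
apply/ffunP=> v; rewrite !ffunE -(en (x, (t0, s0))); congr (e _ _).
have -> : (h, 0) *+ n = (h *+ n, 0) :> G4.
  elim: n {n0 en} => [|n IH]; first by rewrite !mulr0n.
  by rewrite !mulrS IH.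
by congr (_, _); rewrite addr0.
Qed.
End RealLayer.

Lemma aperiodic_tile_of_colouring :
  (exists al, colouring al) -> (forall al, colouring al -> ~ periodic_fun al) ->
  exists (G0 : finZmodType) (F : set (int * int * G0)%type),
    [/\ finite_set F, F !=set0, tiles F & ~ periodically_tiles F].
Proof.
move=> [al al_col] nper.
apply: (aperiodic_tile_of_bits var_invs_neq0 var_cls_distinct).
  exists (extension al); first exact: extension_system.
  by move=> c cP g; apply: extension_nae.
move=> e esys eweak /real_periodic; apply: nper.
exact: real_colouring.
Qed.
End Colouring.
(** * The aperiodic sudoku *)

Notation Z8 := 'Z_8.

Lemma residues3P n (P : 'I_n.+1 -> 'I_n.+1 -> 'I_n.+1 -> bool) :
  all (fun a => all (fun b => all (P a b) (residues n)) (residues n)) (residues n) ->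
  forall a b c, P a b c.
Proof.
move=> /allP PP a; apply: residues2P; exact: PP (mem_residues a).
Qed.

Lemma intr_eq0_Z8 (m : int) : (m%:~R == 0 :> Z8) = (8 %| m)%Z.
Proof.
apply/eqP/idP=> [|/dvdzP[n ->]]; last first.
  by rewrite intrM (_ : 8%:~R = 0 :> Z8) ?mulr0 //; exact: val_inj.
rewrite {1}(divz_eq m 8) intrD intrM (_ : 8%:~R = 0 :> Z8); last exact: val_inj.
rewrite mulr0 add0r => /(congr1 val) /=.
have : (0 <= (m %% 8)%Z) by rewrite modz_ge0.
have : ((m %% 8)%Z < 8) by rewrite ltz_pmod.
case E : (m %% 8)%Z => [r|//] r8 _; rewrite -pmulrn val_Zp_nat // modn_small //.
by move=> /= r0; apply/dvdzP; exists (m %/ 8)%Z; rewrite {1}(divz_eq m 8) E r0 addr0.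
Qed.

Lemma intr_Z8_surj (c : Z8) : exists m : int, m%:~R = c.
Proof. by exists (Posz c); rewrite -pmulrn natr_Zp. Qed.

(** The hypothesis says that [al] is odd, and odd squares are 1 mod 8. *)
Lemma unit_Z8 (al : Z8) : al *+ 4 != 0 -> al * al = 1.
Proof.
have H : all (fun al : 'I_8 => ((al : Z8) *+ 4 != 0) ==> ((al : Z8) * al == 1)) (residues 7).
  by vm_compute.
by move=> a4; apply/eqP; exact: (implyP (allP H _ (mem_residues al))).
Qed.

Lemma regular_Z8 (al m : Z8) : al *+ 4 != 0 -> (al * m == 0) = (m == 0).
Proof.
move/unit_Z8 => al2; apply/eqP/eqP => [|->]; last by rewrite mulr0.
by move/(congr1 ( *%R al)); rewrite mulrA al2 mul1r mulr0.
Qed.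

(** Each of the four conditions excludes at most one of the five candidates. *)
Lemma free_class (al x a b : Z8) : al *+ 4 != 0 ->
  exists2 j : nat, (j < 5)%N & [/\ al * (x + j%:R) + a != 0, al * (x + j%:R) + b != 0,
    al * (x + j%:R + 2%:R) + a != 0 & al * (x + j%:R + 2%:R) + b != 0].
Proof.
have H : all (fun x => all (fun a => all (fun b => has (fun j : nat =>
    [&& (x : Z8) + inZp j + a != 0, (x : Z8) + inZp j + b != 0,
    (x : Z8) + inZp j + inZp 2 + a != 0 & (x : Z8) + inZp j + inZp 2 + b != 0]) (iota 0 5))
    (residues 7)) (residues 7)) (residues 7).
  by vm_compute.
move=> a4; have al2 := unit_Z8 a4.
have /hasP[j] := @residues3P 7 _ H x (al * a) (al * b).
rewrite mem_iota /= => j5 /and4P[A B C D]; exists j => //.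
have N n : (inZp n : Z8) = n%:R by rewrite Zp_nat.
have E c z : al * c + z = al * (c + al * z) by rewrite mulrDr mulrA al2 mul1r.
by rewrite !E !regular_Z8 // -!N.
Qed.

(** Otherwise some [t] avoiding the four residues [0], [m], [al * s] and [m - al * s] refutes the
    hypothesis. *)
Lemma forced_sum (al s m : Z8) : al *+ 4 != 0 -> m != 0 ->
  (forall t : Z8, t != 0 -> m - t != 0 ->
     [\/ s = al * t, s = al * (m - t) | s = al * m]) -> s = al * m.
Proof.
have H : all (fun s => all (fun m => has (fun t : 'I_8 =>
    [&& (t : Z8) != 0, (m : Z8) - t != 0, (s : Z8) != t & (s : Z8) != (m : Z8) - t])
    (residues 7) || ((m : Z8) == 0)) (residues 7)) (residues 7).
  by vm_compute.
move=> a4 m0 st; have al2 := unit_Z8 a4.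
have := @residues2P 7 _ H (al * s) m; rewrite (negPf m0) orbF => /hasP[t _].
have E c : s = al * c -> al * s = c by move=> ->; rewrite mulrA al2 mul1r.
case/and4P=> t0 mt0 /eqP n1 /eqP n2.
by have [/E|/E|] := st t t0 mt0.
Qed.

(** Where the affine digit is 0, the last nonzero digit lies higher up and is left free. *)
Definition affine_or_zero (j : nat) (u c z : Z8) :=
  z = u * j%:R + c \/ u * j%:R + c = 0.

(* [X j], [Y j], [S], [D] are read at [x + 8 j y], [y + 8 j x], [x + y], [x - y].  The
   premises of the last two rules detect that [x] (resp. [y]) is divisible by a higher
   power of 8 than the other coordinate. *)
Definition sudoku (X Y : nat -> int -> Z8) (S D : int -> Z8) := forall x y : int,
  [/\ [\/ X 0%N x + Y 0%N y = 0, S (x + y) = X 0%N x, S (x + y) = Y 0%N y |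
          S (x + y) = X 0%N x + Y 0%N y],
      [\/ X 0%N x = Y 0%N y, D (x - y) = X 0%N x, D (x - y) = - Y 0%N y |
          D (x - y) = X 0%N x - Y 0%N y],
      forall u, u *+ 2 != 0 -> Y 0%N y = u -> S (x + y) = u -> D (x - y) = - u ->
        exists c, forall j, (j < 6)%N -> affine_or_zero j u c (X j (x + 8 * j%:Z * y)) &
      forall u, u *+ 2 != 0 -> X 0%N x = u -> S (x + y) = u -> D (x - y) = u ->
        exists c, forall j, (j < 6)%N -> affine_or_zero j u c (Y j (y + 8 * j%:Z * x))].

(* The first base-8 digits are visible, up to a translation and a scaling. *)
Definition level (al : Z8) (x0 y0 : int) (X Y : nat -> int -> Z8) (S D : int -> Z8) :=
  forall m : int, m%:~R != 0 :> Z8 ->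
  [/\ forall j, (j < 6)%N -> X j (x0 + m) = al * m%:~R,
      forall j, (j < 6)%N -> Y j (y0 + m) = al * m%:~R,
      S (x0 + y0 + m) = al * m%:~R & D (x0 - y0 + m) = al * m%:~R].

(* The lines of [j] through [(x, 1)] and of [j + 1] through [(x + 1, 1)] meet at
   [(x - j, 2)]; a suitable [j] makes both values visible there, which identifies the
   constants of the two starting points. *)
Lemma rigidity (H : nat -> int -> Z8) al : al *+ 4 != 0 ->
  (forall x (v : nat), v \in [:: 1; 2]%N -> exists c, forall j, (j < 6)%N ->
     affine_or_zero j (al * v%:R) c (H j (x + j%:Z * v%:Z))) ->
  exists k, forall j m, (j < 6)%N ->
    H j m = al * m%:~R + k \/ al * m%:~R + k = 0.
Proof.
move=> a4 HH.
have lines x (v : nat) : v \in [:: 1; 2]%N -> exists a, forall j m, (j < 6)%N ->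
    m = x + j%:Z * v%:Z -> H j m = al * m%:~R + a \/ al * m%:~R + a = 0.
  move=> v12; have [c Hc] := HH x v v12; exists (c - al * x%:~R) => j m j6 ->.
  have -> : al * (x + j%:Z * v%:Z)%:~R + (c - al * x%:~R) = al * v%:R * j%:R + c.
    rewrite intrD intrM -!pmulrn; ring.
  exact: Hc.
have /choice[a Ha] x := lines x 1%N isT.
have aS x : a x = a (x + 1).
  apply: contrapT => ab.
  have [j j5 [A B C D]] := free_class x%:~R (a x) (a (x + 1)) a4.
  have xj : (x + j%:Z)%:~R = x%:~R + j%:R :> Z8 by rewrite intrD -pmulrn.
  have xj2 : (x + j%:Z + 2)%:~R = x%:~R + j%:R + 2%:R :> Z8 by rewrite intrD xj.
  have Hj m n z : (n < 6)%N -> m = x - j%:Z + n%:Z * 2%:Z -> m%:~R = z :> Z8 ->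
      forall c, (forall j0 m0, (j0 < 6)%N -> m0 = x - j%:Z + j0%:Z * 2%:Z ->
        H j0 m0 = al * m0%:~R + c \/ al * m0%:~R + c = 0) ->
      H n m = al * z + c \/ al * z + c = 0.
    by move=> n6 -> <- c; apply.
  have [c Hc] := lines (x - j%:Z) 2%N isT.
  have Pc := Hj (x + j%:Z) j _ ltac:(lia) ltac:(lia) xj c Hc.
  have Qc := Hj (x + j%:Z + 2) j.+1 _ ltac:(lia) ltac:(lia) xj2 c Hc.
  have P : H j (x + j%:Z) = al * (x%:~R + j%:R) + a x.
    by have [||//|/eqP] := Ha x j (x + j%:Z); rewrite ?xj ?(negPf A) //; lia.
  have Q : H j.+1 (x + j%:Z + 2) = al * (x%:~R + j%:R + 2%:R) + a (x + 1).
    by have [||//|/eqP] := Ha (x + 1) j.+1 (x + j%:Z + 2); rewrite ?xj2 ?(negPf D) //; lia.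
  rewrite P in Pc; rewrite Q in Qc.
  (* If both values follow the line of slope 2, its constant equals both [a x] and [a (x + 1)]. If
     one does, the zero at the other point contradicts [B] or [C]; two zeros would give
     [al * 2 = 0]. *)
  case: Pc => [/addrI ac|zc]; case: Qc => [/addrI bc|zc'].
  - by apply: ab; rewrite ac bc.
  - by move/eqP: zc'; rewrite -ac (negPf C).
  - by move/eqP: zc; rewrite -bc (negPf B).
  - have : al * 2%:R == 0.
      apply/eqP; rewrite -[RHS](subrr 0) -{1}zc' -zc; ring.
    by rewrite regular_Z8.
have aE x : a x = a 0.
  by elim/int_shift_ind: x => // x; rewrite aS.
exists (a 0) => j m j6; rewrite -(aE (m - j%:Z)).
by apply: Ha => //; lia.
Qed.

Lemma origin (al k : Z8) : al *+ 4 != 0 -> exists x0 : int, al * x0%:~R = - k.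
Proof.
move=> a4; have [x0 x0E] := intr_Z8_surj (- (al * k)).
by exists x0; rewrite x0E mulrN mulrA unit_Z8 // mul1r.
Qed.

(** At [(x0 + 8 x, y0 + 8 y)] the form [x + 8 j y] becomes [x0 + 8 j y0 + 8 (x + 8 j y)], so the
    samples are indexed by the same forms. *)
Definition sub_line (X : nat -> int -> Z8) (x0 y0 : int) j m :=
  X j (x0 + 8 * j%:Z * y0 + 8 * m).

(** At [(x0 + 8 x, y0 + v)] with [v] = 1 or 2, the values of [Y 0], [S] and [D] are visible and meet
    the premises of the row rule with [u = al * v]. Its conclusion concerns the samples at
    [x + j v], as [rigidity] requires. *)
Lemma sub_rows X Y S D al x0 y0 : al *+ 4 != 0 -> sudoku X Y S D ->
    level al x0 y0 X Y S D -> exists k, forall j m, (j < 6)%N ->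
  sub_line X x0 y0 j m = al * m%:~R + k \/ al * m%:~R + k = 0.
Proof.
move=> a4 sol lev; apply: rigidity => // x v v12.
have v0 : v%:R != 0 :> Z8 by move: v12; rewrite !inE => /orP[]/eqP->.
have u2 : (al * v%:R) *+ 2 != 0.
  by rewrite -mulrnAr regular_Z8 //; move: v12; rewrite !inE => /orP[]/eqP->.
have e8 : (8%:Z)%:~R = 0 :> Z8 by exact: val_inj.
have [_ _ E _] := sol (x0 + 8 * x) (y0 + v%:Z).
have vE : v%:Z%:~R = v%:R :> Z8 by [].
have vE' : (8 * x + v%:Z)%:~R = v%:R :> Z8 by rewrite intrD intrM e8 mul0r add0r.
have vE'' : (8 * x - v%:Z)%:~R = - v%:R :> Z8 by rewrite intrB intrM e8 mul0r add0r.
have [|||c Hc] := E _ u2.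
- have [|_ -> //] := lev (v%:Z); by rewrite vE.
- have -> : x0 + 8 * x + (y0 + v%:Z) = x0 + y0 + (8 * x + v%:Z) by ring.
  have [|_ _ -> _] := lev (8 * x + v%:Z); by rewrite vE'.
- have -> : x0 + 8 * x - (y0 + v%:Z) = x0 - y0 + (8 * x - v%:Z) by ring.
  have [|_ _ _ ->] := lev (8 * x - v%:Z); by rewrite vE'' ?oppr_eq0 ?mulrN.
exists c => j /Hc; rewrite /sub_line.
by congr (affine_or_zero _ _ _ (X _ _)); ring.
Qed.

(** Exchanging [x] and [y] negates [x - y]; the outer sign keeps visible digits of the form
    [al * m]. *)
Definition mirror (D : int -> Z8) m := - D (- m).

Lemma sudoku_swap X Y S D : sudoku X Y S D -> sudoku Y X S (mirror D).
Proof.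
move=> sol x y; have [A B E F] := sol y x.
rewrite /mirror opprB (addrC x); split=> [||u u2 h1 h2 h3|u u2 h1 h2 h3].
- case: A => [h|h|h|h]; [apply: Or41|apply: Or43|apply: Or42|apply: Or44] => //.
    by rewrite addrC.
  by rewrite h addrC.
- case: B => [h|h|h|h]; [apply: Or41|apply: Or43|apply: Or42|apply: Or44] => //.
  + by rewrite h.
  + by rewrite h opprK.
  + by rewrite h opprB.
- by apply: F => //; rewrite -[RHS]opprK -h3 opprK.
- by apply: E => //; rewrite -h3 opprK.
Qed.

Lemma level_swap al x0 y0 X Y S D :
  level al x0 y0 X Y S D -> level al y0 x0 Y X S (mirror D).
Proof.
move=> lev m m0; have [A B E _] := lev m m0; have [|_ _ _ F] := lev (- m).
  by rewrite mulrNz oppr_eq0.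
split=> //; first by rewrite (addrC y0).
rewrite /mirror (_ : - (y0 - x0 + m) = x0 - y0 - m); last by ring.
by rewrite F mulrNz mulrN opprK.
Qed.

Section Subsample.
Variables (X Y : nat -> int -> Z8) (S D : int -> Z8) (al : Z8) (x0 y0 : int).
Hypothesis sol : sudoku X Y S D.
Hypothesis a4 : al *+ 4 != 0.
Hypothesis lev : level al x0 y0 X Y S D.

Notation subX := (sub_line X x0 y0).
Notation subY := (sub_line Y y0 x0).
Definition subS m := S (x0 + y0 + 8 * m).
Definition subD m := D (x0 - y0 + 8 * m).

Lemma sub_sudoku : sudoku subX subY subS subD.
Proof.
move=> x y; rewrite /sub_line /subS /subD !mulr0 !mul0r !addr0.
have [A B E F] := sol (x0 + 8 * x) (y0 + 8 * y).
have sE : x0 + y0 + 8 * (x + y) = x0 + 8 * x + (y0 + 8 * y) by ring.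
have dE : x0 - y0 + 8 * (x - y) = x0 + 8 * x - (y0 + 8 * y) by ring.
rewrite sE dE; split=> // u u2 h1 h2 h3.
  have [c Hc] := E u u2 h1 h2 h3; exists c => j /Hc.
  by congr (affine_or_zero _ _ _ (X _ _)); ring.
have [c Hc] := F u u2 h1 h2 h3; exists c => j /Hc.
by congr (affine_or_zero _ _ _ (Y _ _)); ring.
Qed.

(** The constants of the rows and columns are absorbed into the new origin. For the sum, all
    splittings of [m] into [t] and [m - t], both nonzero mod 8, constrain one value, which
    [forced_sum] determines; the difference is similar. *)
Lemma sub_level : exists x1 y1, level al x1 y1 subX subY subS subD.
Proof.
have [k Xk] := sub_rows a4 sol lev.
have [l Yl] := sub_rows a4 (sudoku_swap sol) (level_swap lev).
have [x1 x1E] := origin k a4; have [y1 y1E] := origin l a4.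
have X1 m j : m%:~R != 0 :> Z8 -> (j < 6)%N -> subX j (x1 + m) = al * m%:~R.
  move=> m0 j6; have := Xk j (x1 + m) j6.
  by rewrite intrD mulrDr x1E addrAC addNr add0r => -[//|/eqP]; rewrite regular_Z8 ?(negPf m0).
have Y1 m j : m%:~R != 0 :> Z8 -> (j < 6)%N -> subY j (y1 + m) = al * m%:~R.
  move=> m0 j6; have := Yl j (y1 + m) j6.
  by rewrite intrD mulrDr y1E addrAC addNr add0r => -[//|/eqP]; rewrite regular_Z8 ?(negPf m0).
exists x1, y1 => m m0; split=> [j|j||]; [exact: X1|exact: Y1| |].
- apply: forced_sum => // t t0 mt0; have [s sE] := intr_Z8_surj t.
  have [A _ _ _] := sub_sudoku (x1 + s) (y1 + (m - s)).
  have := A; rewrite X1 ?sE // Y1 ?intrB ?sE //.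
  rewrite (_ : x1 + s + (y1 + (m - s)) = x1 + y1 + m); last by ring.
  rewrite -mulrDr subrKC => -[/eqP|->|->|->]; rewrite ?regular_Z8 ?(negPf m0) //.
  + exact: Or31.
  + exact: Or32.
  + exact: Or33.
- apply: forced_sum => // t t0 mt0; have [s sE] := intr_Z8_surj t.
  have [_ B _ _] := sub_sudoku (x1 + s) (y1 + (s - m)).
  have tm0 : t - m%:~R != 0 by rewrite -oppr_eq0 opprB.
  have := B; rewrite X1 ?sE // Y1 ?intrB ?sE //.
  rewrite (_ : x1 + s - (y1 + (s - m)) = x1 - y1 + m); last by ring.
  rewrite -mulrBr -mulrN !opprB (_ : t + (m%:~R - t) = m%:~R); last by ring.
  case=> [/eqP|->|->|->].
  + by rewrite -subr_eq0 -mulrBr opprB (_ : t + (m%:~R - t) = m%:~R) ?regular_Z8 ?(negPf m0) //; ring.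
  + exact: Or31.
  + exact: Or32.
  + exact: Or33.
Qed.
End Subsample.

(** A period [8 * Q] gives the samples the period [Q]. A period not divisible by 8 changes the digit
    between two visible places. *)
Lemma sudoku_aperiodic P X Y S D al x0 y0 : al *+ 4 != 0 ->
  sudoku X Y S D -> level al x0 y0 X Y S D -> (0 < P)%N ->
  ~ (forall m, X 0%N (m + P%:Z) = X 0%N m).
Proof.
move=> a4; elim/ltn_ind: P X Y S D x0 y0 => P IH X Y S D x0 y0 sol lev P0 per.
have [d8|] := boolP (8 %| P%:Z)%Z.
  have [x1 [y1 lev']] := sub_level sol a4 lev.
  have [Q PE] : exists Q : nat, P = (8 * Q)%N.
    by move: d8 => /dvdzP[z zE]; exists `|z|%N; lia.
  apply: (IH Q _ _ _ _ _ _ _ _ lev'); [lia|exact: sub_sudoku|lia|].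
  move=> m; rewrite /sub_line -[RHS]per; congr (X _ _); rewrite PE PoszM; ring.
rewrite -intr_eq0_Z8 => P8.
(* [m = 1] fails only for [P] congruent to -1, and then [m = 2] works. *)
have [m m0 mP] : exists2 m : int, m%:~R != 0 :> Z8 & (m + P%:Z)%:~R != 0 :> Z8.
  have [E|] := eqVneq ((1 + P%:Z)%:~R : Z8) 0; last by exists 1.
  by exists 2 => //; rewrite (_ : 2 + P%:Z = 1 + (1 + P%:Z)) // intrD E addr0.
have [A _ _ _] := lev m m0; have [B _ _ _] := lev _ mP.
move: P8; apply/negP; rewrite negbK -(regular_Z8 _ a4).
have := B 0%N isT; rewrite addrA per A // intrD mulrDr => /eqP.
by rewrite -subr_eq0 opprD addrA subrr sub0r oppr_eq0.
Qed.

(** * Functions constant along lines, encoded as colourings *)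

Section LineSystem.
Variables (J A : finType) (w : J -> int * int) (rule : (J -> A) -> bool -> Prop).
Hypothesis w_neq0 : forall j, w j != 0.

Definition line_system (F : J -> int * int -> A) (q : int * int -> bool) :=
  [/\ forall x, rule (F^~ x) (q x), forall j x, F j (x + w j) = F j x,
      forall x, q (x + (1, 0)) = q x & forall x, q (x + (0, 1)) = ~~ q x].

(** One-hot encoding: the bit [(j, a)] says that [F j] has value [a]; the last bit is [q]. *)
Let V : finType := (J * A + unit)%type.

Let Omega (om : {ffun V -> bool}) : bool := `[<exists F : J -> A,
  (forall j a, om (inl (j, a)) = (F j == a)) /\ rule F (om (inr tt))>].

Let W : seq (V * (int * int) * bool) :=
  [:: (inr tt, (1, 0), false); (inr tt, (0, 1), true)] ++
  [seq (inl ja, w ja.1, false) | ja <- enum {: J * A}].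

Lemma aperiodic_tile_of_lines :
  (exists F q, line_system F q) ->
  (forall F q, line_system F q -> ~ forall j, periodic_fun (F j)) ->
  exists (G0 : finZmodType) (F : set (int * int * G0)%type),
    [/\ finite_set F, F !=set0, tiles F & ~ periodically_tiles F].
Proof.
move=> [F [q [Fr Fw q1 q2]]] nper.
apply: (@aperiodic_tile_of_colouring V Omega W).
- by move=> z; rewrite !inE => /or3P[/eqP->|/eqP->|/mapP[[j a] _ ->]] //; exact: w_neq0.
- exists (fun x => [ffun v : V => match v with inl ja => F ja.1 x == ja.2 | inr _ => q x end]).
  split=> [x|z].
    apply/asboolP; exists (F^~ x); split=> [j a|]; first by rewrite ffunE.
    by rewrite ffunE.
  rewrite !inE => /or3P[/eqP->|/eqP->|/mapP[[j a] _ ->]] x; rewrite !ffunE /=.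
  + by rewrite q1 addbF.
  + by rewrite q2 addbT.
  + by rewrite Fw addbF.
- move=> al [alO alW] per.
  have /choice[F' F'P] x : exists F : J -> A, (forall j a, al x (inl (j, a)) = (F j == a)) /\
      rule F (al x (inr tt)) by apply/asboolP; exact: alO.
  apply: (nper (fun j x => F' x j) (fun x => al x (inr tt))); first split=> [x|j x|x|x].
  + exact: (F'P x).2.
  + apply/eqP; rewrite -(F'P _).1.
    rewrite (alW (inl (j, F' x j), w j, false)); last first.
      by rewrite !inE; apply/or3P/Or33/mapP; exists (j, F' x j); rewrite ?mem_enum.
    by rewrite /= addbF (F'P _).1.
  + by rewrite (alW (inr tt, (1, 0), false)) ?inE ?eqxx //= addbF.
  + by rewrite (alW (inr tt, (0, 1), true)) ?inE ?eqxx ?orbT //= addbT.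
  + move=> j h; have [n n0 aln] := per h; exists n => // x.
    by apply/eqP; rewrite -(F'P _).1 aln (F'P _).1.
Qed.
End LineSystem.

Lemma line_invariant T (f : int * int -> T) (a b : int) :
  (forall x, f (x + (a, b)) = f x) -> forall n x y, f (x + a * n, y + b * n) = f (x, y).
Proof.
move=> fab; elim/int_shift_ind => [n|x y]; last by rewrite !mulr0 !addr0.
have E x y : f (x + a * (n + 1), y + b * (n + 1)) = f (x + a * n, y + b * n).
  by rewrite -[RHS]fab; congr (f (_, _)); rewrite /=; ring.
by split=> H x y; have := H x y; rewrite E.
Qed.

(* The last nonzero base-8 digit, with [Phi 0 = 0]. *)
Definition Phi (m : int) : Z8 := (m %/ (8 ^ (logn 2 `|m| %/ 3))%:Z)%Z%:~R.

(** The exponent [logn 2 _ %/ 3] is the 8-adic valuation, here 0. *)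
Lemma Phi_mod m : m%:~R != 0 :> Z8 -> Phi m = m%:~R.
Proof.
rewrite intr_eq0_Z8 => m8; have m0 : m != 0 by apply: contraNneq m8 => ->.
rewrite /Phi divn_small ?expn0 ?divz1 // ltnNge -pfactor_dvdn ?absz_gt0 //.
Qed.

Lemma Phi_scale m : Phi (8 * m) = Phi m.
Proof.
have [->|m0] := eqVneq m 0; first by rewrite mulr0.
rewrite /Phi abszM lognM ?absz_gt0 // (_ : logn 2 `|8| = 3) //.
by rewrite divnDl // divnn /= add1n expnS PoszM divzMpl.
Qed.
(** The pointwise form of [sudoku], a relation between finitely many values. *)
Definition local_rule (X Y : nat -> Z8) (S D : Z8) :=
  [/\ [\/ X 0%N + Y 0%N = 0, S = X 0%N, S = Y 0%N | S = X 0%N + Y 0%N],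
      [\/ X 0%N = Y 0%N, D = X 0%N, D = - Y 0%N | D = X 0%N - Y 0%N],
      forall u, u *+ 2 != 0 -> Y 0%N = u -> S = u -> D = - u ->
        exists c, forall j, (j < 6)%N -> affine_or_zero j u c (X j) &
      forall u, u *+ 2 != 0 -> X 0%N = u -> S = u -> D = u ->
        exists c, forall j, (j < 6)%N -> affine_or_zero j u c (Y j)].

Lemma local_rule_ext X X' Y Y' S D :
  (forall j, (j < 6)%N -> X j = X' j) -> (forall j, (j < 6)%N -> Y j = Y' j) ->
  local_rule X Y S D -> local_rule X' Y' S D.
Proof.
move=> XE YE; rewrite /local_rule !XE // !YE // => -[A B E F].
split=> // u u2 h0 h1 h2.
  by have [c Hc] := E u u2 h0 h1 h2; exists c => j j6; rewrite -XE //; exact: Hc.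
by have [c Hc] := F u u2 h0 h1 h2; exists c => j j6; rewrite -YE //; exact: Hc.
Qed.

Lemma sudokuP X Y S D :
  (forall x y, local_rule (fun j => X j (x + 8 * j%:Z * y))
     (fun j => Y j (y + 8 * j%:Z * x)) (S (x + y)) (D (x - y))) ->
  sudoku X Y S D.
Proof.
by move=> loc x y; have := loc x y; rewrite /local_rule !mulr0 !mul0r !addr0.
Qed.

Definition Phi_rule x y := local_rule (fun j => Phi (x + 8 * j%:Z * y))
  (fun j => Phi (y + 8 * j%:Z * x)) (Phi (x + y)) (Phi (x - y)).

Lemma Phi_rule_scale x y : Phi_rule x y -> Phi_rule (8 * x) (8 * y).
Proof.
rewrite /Phi_rule -mulrDr -mulrBr !Phi_scale.
have E a b : (fun j : nat => Phi (8 * a + 8 * j%:Z * (8 * b))) =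
    (fun j => Phi (a + 8 * j%:Z * b)).
  by apply/funext => j; rewrite -[RHS]Phi_scale; congr Phi; ring.
by rewrite (E x y) (E y x).
Qed.

Lemma Phi0 : Phi 0 = 0.
Proof. by rewrite /Phi div0z. Qed.

(** [Phi] discards the common factor 8, leaving the residue of [x + j y], affine in [j], unless it
    is 0. *)
Lemma Phi_row (x y : int) : y%:~R != 0 :> Z8 ->
  exists c, forall j, (j < 6)%N ->
    affine_or_zero j y%:~R c (Phi (8 * x + 8 * j%:Z * y)).
Proof.
move=> y0; exists x%:~R => j _; rewrite /affine_or_zero.
have E : y%:~R * j%:R + x%:~R = (x + j%:Z * y)%:~R :> Z8.
  by rewrite intrD intrM -pmulrn addrC mulrC.
have [|xy0] := eqVneq (y%:~R * j%:R + x%:~R : Z8) 0; [by right|left].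
rewrite (_ : 8 * x + _ = 8 * (x + j%:Z * y)); last by ring.
by rewrite Phi_scale Phi_mod -E.
Qed.

(** If one coordinate is divisible by 8, [Phi_row] gives its rule, and the other rule would need u =
    -u. If neither is, the premises fail: a visible sum or difference would force a coordinate to
    vanish mod 8, and if both are invisible then 2u = 0. *)
Lemma Phi_rule_primitive (x y : int) :
  (x%:~R != 0 :> Z8) || (y%:~R != 0 :> Z8) -> Phi_rule x y.
Proof.
move=> xy0; rewrite /Phi_rule /local_rule !mulr0 !mul0r !addr0.
have sE : (x + y)%:~R = x%:~R + y%:~R :> Z8 by rewrite intrD.
have dE : (x - y)%:~R = x%:~R - y%:~R :> Z8 by rewrite intrB.
have [x0|x0] := eqVneq (x%:~R : Z8) 0.
  rewrite x0 eqxx /= in xy0.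
  have SE : Phi (x + y) = Phi y by rewrite !Phi_mod // sE x0 add0r.
  have DE : Phi (x - y) = - Phi y by rewrite !Phi_mod // dE x0 sub0r ?oppr_eq0.
  split=> [||u _ <- _ _|u u2 _ h1 h2]; [exact: Or43|exact: Or43| |].
  - rewrite Phi_mod //; move/eqP: x0; rewrite intr_eq0_Z8 => /dvdzP[x' ->].
    by rewrite mulrC; exact: Phi_row.
  - by move: u2; rewrite mulr2n -{1}h2 DE -h1 SE addNr eqxx.
have [y0|y0] := eqVneq (y%:~R : Z8) 0.
  have SE : Phi (x + y) = Phi x by rewrite !Phi_mod // sE y0 addr0.
  have DE : Phi (x - y) = Phi x by rewrite !Phi_mod // dE y0 subr0.
  split=> [||u u2 _ h1 h2|u _ <- _ _]; [exact: Or42|exact: Or42| |].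
  - by move: u2; rewrite mulr2n -{1}h1 SE -DE h2 addNr eqxx.
  - rewrite Phi_mod //; move/eqP: y0; rewrite intr_eq0_Z8 => /dvdzP[y' ->].
    by rewrite mulrC; exact: Phi_row.
rewrite (Phi_mod x0) (Phi_mod y0).
have S1 : Phi (x + y) = x%:~R + y%:~R \/ x%:~R + y%:~R = 0 :> Z8.
  by have [|] := eqVneq (x%:~R + y%:~R : Z8) 0; [right|rewrite -sE => /Phi_mod ->; left].
have D1 : Phi (x - y) = x%:~R - y%:~R \/ x%:~R - y%:~R = 0 :> Z8.
  by have [|] := eqVneq (x%:~R - y%:~R : Z8) 0; [right|rewrite -dE => /Phi_mod ->; left].
have contra (u : Z8) : u *+ 2 != 0 -> u = x%:~R \/ u = y%:~R ->
    x%:~R + y%:~R = 0 :> Z8 -> x%:~R - y%:~R = 0 :> Z8 -> False.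
  move=> u2 uE s0 /subr0_eq xy; move/eqP: u2; apply.
  by rewrite mulr2n -[RHS]s0; case: uE => ->; rewrite xy.
split=> [||u u2 h0 h1 h2|u u2 h0 h1 h2].
- by case: S1; [exact: Or44|exact: Or41].
- by case: D1; [exact: Or44|move=> /subr0_eq; exact: Or41].
- exfalso; case: S1 => [S1|S1].
    by move: h1; rewrite S1 -h0 -{2}[y%:~R]add0r => /addIr/eqP; rewrite (negPf x0).
  case: D1 => [D1|D1]; last by apply: (contra u) => //; right.
  by move: h2; rewrite D1 -h0 -[RHS]add0r => /addIr/eqP; rewrite (negPf x0).
- exfalso; case: S1 => [S1|S1].
    by move: h1; rewrite S1 -h0 -{2}[x%:~R]addr0 => /addrI/eqP; rewrite (negPf y0).
  case: D1 => [D1|D1]; last by apply: (contra u) => //; left.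
  by move: h2; rewrite D1 -h0 -[RHS]addr0 => /addrI/eqP; rewrite oppr_eq0 (negPf y0).
Qed.

Lemma Phi_rule_all x y : Phi_rule x y.
Proof.
have [n] := ubnP (`|x| + `|y|)%N; elim: n x y => // n IH x y le_n.
have [|] := boolP ((x%:~R != 0 :> Z8) || (y%:~R != 0 :> Z8)).
  exact: Phi_rule_primitive.
rewrite negb_or !negbK !intr_eq0_Z8 => /andP[/dvdzP[x' xE] /dvdzP[y' yE]].
have [x0|x0] := eqVneq x 0; have [y0|y0] := eqVneq y 0; last 3 first.
1-3: by rewrite xE yE !(mulrC _ 8); apply: Phi_rule_scale; apply: IH; lia.
rewrite x0 y0 /Phi_rule /local_rule !mulr0 addr0 subr0 Phi0.
by split=> [||u u2 <-|u u2 <-]; [exact: Or42|exact: Or41|..];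
  exists 0 => j _; right; rewrite mul0r addr0.
Qed.

(** * The concrete rule: a solution, and no periodic one *)

Definition form_index : finType := ('I_6 + 'I_6 + bool + option bool)%type.
Definition xf (j : nat) : form_index := inl (inl (inl (inord j))).
Definition yf (j : nat) : form_index := inl (inl (inr (inord j))).
Definition sf : form_index := inl (inr true).
Definition df : form_index := inl (inr false).
(** The last three forms carry the auxiliary functions that reveal residues mod 8. *)
Definition bxf : form_index := inr (Some true).
Definition byf : form_index := inr (Some false).
Definition bsf : form_index := inr None.

Definition form_value (i : form_index) (p : int * int) : int :=
  match i with
  | inl (inl (inl j)) => p.1 + 8 * (j : nat)%:Z * p.2
  | inl (inl (inr j)) => p.2 + 8 * (j : nat)%:Z * p.1
  | inl (inr b) => if b then p.1 + p.2 else p.1 - p.2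
  | inr (Some b) => if b then p.1 else p.2
  | inr None => p.1 + p.2
  end.

(** A primitive vector of the kernel of the form: invariance along it is dependence on the value of
    the form alone. *)
Definition direction (i : form_index) : int * int :=
  match i with
  | inl (inl (inl j)) => (8 * (j : nat)%:Z, - 1)
  | inl (inl (inr j)) => (1, - (8 * (j : nat)%:Z))
  | inl (inr b) => (1, if b then - 1 else 1)
  | inr (Some b) => if b then (0, 1) else (1, 0)
  | inr None => (1, - 1)
  end.

Lemma direction_neq0 i : direction i != 0.
Proof.
by case: i => [[[j|j]|[]]|[[]|]]; apply/eqP => -[].
Qed.

Lemma form_value_direction i p : form_value i (p + direction i) = form_value i p.
Proof.
by case: p => x y; case: i => [[[j|j]|[]]|[[]|]] /=; ring.
Qed.

(* [q] is the parity of [y], up to negation: it makes the slope of the residues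
   [F byf] odd. *)
Definition rule (F : form_index -> Z8) (q : bool) :=
  [/\ F bsf = F bxf + F byf, odd (F byf) = q,
      [/\ F bxf != 0 -> forall j, (j < 6)%N -> F (xf j) = F bxf,
          F byf != 0 -> forall j, (j < 6)%N -> F (yf j) = F byf,
          F bsf != 0 -> F sf = F bsf &
          F bxf - F byf != 0 -> F df = F bxf - F byf] &
      local_rule (F \o xf) (F \o yf) (F sf) (F df)].

Definition solution (i : form_index) (p : int * int) : Z8 :=
  if i is inr _ then (form_value i p)%:~R else Phi (form_value i p).

Lemma intr_add8 (x z : int) : (x + 8 * z)%:~R = x%:~R :> Z8.
Proof.
by rewrite intrD intrM (_ : 8%:~R = 0 :> Z8) ?mul0r ?addr0 //; exact: val_inj.
Qed.

Lemma odd_Z8D (a b : Z8) : odd (a + b)%R = odd a (+) odd b.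
Proof.
have := @residues2P 7 (fun a b : 'I_8 => odd ((a : Z8) + b)%R == odd a (+) odd b).
by move=> H; apply/eqP; apply: H; vm_compute.
Qed.

Lemma solution_system : exists F q, line_system direction rule F q.
Proof.
exists solution, (fun p => odd (p.2%:~R : Z8)).
split=> [[x y]|j p|[x y]|[x y]].
- split=> //=; rewrite /solution /=; first by rewrite intrD.
    split=> [x0 j j6|y0 j j6||]; rewrite ?inordK //.
    + by rewrite -mulrA Phi_mod intr_add8.
    + by rewrite -mulrA Phi_mod intr_add8.
    + exact: Phi_mod.
    + by rewrite -intrB; exact: Phi_mod.
  by apply: local_rule_ext (Phi_rule_all x y) => j j6; rewrite /= inordK.
- by rewrite /solution form_value_direction.
- by rewrite /= addr0.
- by rewrite -[LHS]/(odd ((y + 1)%:~R : Z8)) intrD odd_Z8D addbT.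
Qed.

(** The auxiliary functions satisfy an additive equation, so [Bx] and [By] are affine with a common
    slope [al]; their zeros [x0], [y0] are the origin of a [level], to which [sudoku_aperiodic]
    applies. *)
Lemma rule_aperiodic F q : line_system direction rule F q ->
  ~ forall i, periodic_fun (F i).
Proof.
move=> [Fr Fd q1 q2] per.
have row j x y : (j < 6)%N -> F (xf j) (x, y) = F (xf j) (x + 8 * j%:Z * y, 0).
  move=> j6; rewrite -(line_invariant (Fd (xf j)) y x y) /= inordK //.
  by congr (F _ (_, _)); ring.
have col j x y : (j < 6)%N -> F (yf j) (x, y) = F (yf j) (0, y + 8 * j%:Z * x).
  move=> j6; rewrite -(line_invariant (Fd (yf j)) (- x) x y) /= inordK //.
  by congr (F _ (_, _)); ring.
have sum i x y : direction i = (1, -1) -> F i (x, y) = F i (x + y, 0).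
  move=> di; have := Fd i; rewrite di => /line_invariant L.
  by rewrite -(L y x y); congr (F _ (_, _)); ring.
have dif x y : F df (x, y) = F df (x - y, 0).
  rewrite -(line_invariant (Fd df) (- y) x y) /=.
  by congr (F _ (_, _)); ring.
have bx x y : F bxf (x, y) = F bxf (x, 0).
  rewrite -(line_invariant (Fd bxf) (- y) x y) /=.
  by congr (F _ (_, _)); ring.
have by_ x y : F byf (x, y) = F byf (0, y).
  rewrite -(line_invariant (Fd byf) (- x) x y) /=.
  by congr (F _ (_, _)); ring.
pose X j m := F (xf j) (m, 0); pose Y j m := F (yf j) (0, m).
pose S m := F sf (m, 0); pose D m := F df (m, 0).
pose Bx m := F bxf (m, 0); pose By m := F byf (0, m).
have BE x y : F bsf (x + y, 0) = Bx x + By y.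
  by rewrite -sum //; have [-> _ _ _] := Fr (x, y); rewrite bx by_.
have [al alE] : exists al, al = Bx 1 - Bx 0 by exists (Bx 1 - Bx 0).
have step x : Bx (x + 1) = Bx x + al.
  have h1 := BE (x + 1) 0; have h2 := BE x 1.
  have h3 := BE 1 0; have h4 := BE 0 1.
  rewrite add0r in h4; rewrite addr0 in h1 h3; rewrite h1 in h2; rewrite h3 in h4.
  apply: (addIr (By 0)); rewrite h2 alE; apply: (addrI (Bx 0)).
  by rewrite addrCA -h4; ring.
have BxE x : Bx x = Bx 0 + al * x%:~R.
  elim/int_shift_ind: x => [x|]; last by rewrite mulr0 addr0.
  rewrite step intrD mulrDr mulr1 addrA.
  by split=> [->//|H]; apply: addIr H.
have ByE y : By y = By 0 + al * y%:~R.
  apply: (addrI (Bx 0)); rewrite -BE add0r addrCA -BxE addrC -BE addr0 //.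
(* As [q] alternates with [y], the parities of [By 0] and [By 1] differ, so [al] is odd. *)
have a4 : al *+ 4 != 0.
  have q0 (y : int) : odd (By y) = q (0, y) by have [_ -> _ _] := Fr (0, y).
  have : odd (By 1) = ~~ odd (By 0).
    by rewrite !q0 -q2; congr q.
  rewrite ByE mulr1 odd_Z8D.
  have H : all (fun a : 'I_8 => odd a ==> ((a : Z8) *+ 4 != 0)) (residues 7).
    by vm_compute.
  move=> E; apply: (implyP (allP H _ (mem_residues al))).
  by case: (odd (By 0)) E => //=; case: (odd al).
have [x0 x0E] := origin (Bx 0) a4; have [y0 y0E] := origin (By 0) a4.
have Bx0 m : Bx (x0 + m) = al * m%:~R.
  by rewrite BxE intrD mulrDr x0E addrA subrr add0r.
have By0 m : By (y0 + m) = al * m%:~R.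
  by rewrite ByE intrD mulrDr y0E addrA subrr add0r.
have sol : sudoku X Y S D.
  apply: sudokuP => x y; have [_ _ _] := Fr (x, y).
  rewrite (sum sf) // dif; apply: local_rule_ext => j j6 /=.
    exact: row.
  exact: col.
have lev : level al x0 y0 X Y S D.
  move=> m m0; have am0 : al * m%:~R != 0 by rewrite regular_Z8.
  split=> [j j6|j j6||].
  - have [_ _ [/= + _ _ _] _] := Fr (x0 + m, 0).
    rewrite -/(Bx _) Bx0 => /(_ am0 j j6) <-.
    by rewrite row // mulr0 addr0.
  - have [_ _ [/= _ + _ _] _] := Fr (0, y0 + m).
    rewrite -/(By _) By0 => /(_ am0 j j6) <-.
    by rewrite col // mulr0 addr0.
  (* Since [By] vanishes at [y0], the auxiliary sum and difference at this point are both
     [al * m]. *)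
  - have [_ _ [/= _ _ + _] _] := Fr (x0 + m, y0).
    rewrite (sum sf) // (sum bsf) // BE -[y0]addr0 By0 mulr0 !addr0 Bx0 => /(_ am0) <-.
    by rewrite /S; congr (F _ (_, _)); ring.
  - have [_ _ [/= _ _ _ +] _] := Fr (x0 + m, y0).
    rewrite bx by_ -/(Bx _) -/(By _) -[y0]addr0 By0 mulr0 subr0 Bx0 addr0 dif.
    move=> /(_ am0) <-; rewrite /D; congr (F _ (_, _)); ring.
have [n n0 Xn] := per (xf 0) (1, 0).
apply: (sudoku_aperiodic a4 sol lev n0) => m; rewrite /X -[RHS]Xn.
have E k : (1, 0) *+ k = (k%:Z, 0) :> (int * int)%type.
  by elim: k => // k IH; rewrite mulrS IH; congr (_, _); rewrite /= -PoszD add1n.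
by rewrite E; congr (F _ (_, _)); rewrite /= addr0.
Qed.

Theorem theorem1p3 :
  exists (G0 : finZmodType) (F : set (int * int * G0)%type),
    [/\ finite_set F, F !=set0, tiles F & ~ periodically_tiles F].
Proof.
exact: aperiodic_tile_of_lines direction_neq0 solution_system rule_aperiodic.
Qed.
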